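(* Let $1\le n<\omega$ be a standard natural number. Over $\mathsf{RCA}_0$: (a) $\mathsf{Elem{\text -}Indec}^n$ implies $\mathsf{B}\Pi^0_n$; (b) $\mathsf{I}\Sigma^0_{n+1}$ implies $\mathsf{Elem{\text -}Indec}^n$.
   Context: $\mathsf{Elem{\text -}Indec}^n$ is the statement: for every $k\in\mathbb{N}$ and every coloring $c:\mathbb{N}^n\to\{0,\dots,k-1\}$ there is a color $d<k$ such that $(\exists^\infty x_1)(\exists^\infty x_2)\cdots(\exists^\infty x_n)[c(x_1,\dots,x_n)=d]$, where $\exists^\infty x$ means ''there are infinitely many $x$''. $\mathsf{B}\Pi^0_n$ is the $\Pi^0_n$ bounding (collection) scheme and $\mathsf{I}\Sigma^0_{n+1}$ the $\Sigma^0_{n+1}$ induction scheme (with set parameters). *)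

(* Defs.v *)
From Stdlib Require Import List Arith.
Import ListNotations.

Set Implicit Arguments.
Unset Strict Implicit.

(** * The language L_2 of second-order arithmetic

    Number variables and set variables are two independent families of de
    Bruijn indices: a number quantifier binds number index 0 and leaves the set
    indices alone, a set quantifier binds set index 0 and leaves the number
    indices alone. *)

Inductive term : Type :=
| Var (i : nat)
| Zero
| One
| Plus (s t : term)
| Times (s t : term).

Inductive formula : Type :=
| fEq (s t : term)
| fLt (s t : term)
| fMem (t : term) (X : nat)
| fBot
| fImp (p q : formula)
| fAnd (p q : formula)
| fOr (p q : formula)
| fAll (p : formula)
| fEx (p : formula)
| fAllS (p : formula)
| fExS (p : formula).

Definition fNot (p : formula) : formula := fImp p fBot.
Definition fIff (p q : formula) : formula := fAnd (fImp p q) (fImp q p).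

Definition scons (A : Type) (x : A) (e : nat -> A) (i : nat) : A :=
  match i with 0 => x | S j => e j end.

Fixpoint tsubst (sigma : nat -> term) (t : term) : term :=
  match t with
  | Var i => sigma i
  | Zero => Zero
  | One => One
  | Plus s t => Plus (tsubst sigma s) (tsubst sigma t)
  | Times s t => Times (tsubst sigma s) (tsubst sigma t)
  end.

Definition tlift (t : term) : term := tsubst (fun i => Var (S i)) t.

Definition up (sigma : nat -> term) : nat -> term :=
  scons (Var 0) (fun i => tlift (sigma i)).

(** Capture-avoiding substitution of terms for the number variables. *)
Fixpoint subst (sigma : nat -> term) (p : formula) : formula :=
  match p with
  | fEq s t => fEq (tsubst sigma s) (tsubst sigma t)
  | fLt s t => fLt (tsubst sigma s) (tsubst sigma t)
  | fMem t X => fMem (tsubst sigma t) X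
  | fBot => fBot
  | fImp p q => fImp (subst sigma p) (subst sigma q)
  | fAnd p q => fAnd (subst sigma p) (subst sigma q)
  | fOr p q => fOr (subst sigma p) (subst sigma q)
  | fAll p => fAll (subst (up sigma) p)
  | fEx p => fEx (subst (up sigma) p)
  | fAllS p => fAllS (subst sigma p)
  | fExS p => fExS (subst sigma p)
  end.

Definition upr (rho : nat -> nat) : nat -> nat :=
  scons 0 (fun i => S (rho i)).

(** Capture-avoiding renaming of the set variables. *)
Fixpoint renS (rho : nat -> nat) (p : formula) : formula :=
  match p with
  | fEq s t => fEq s t
  | fLt s t => fLt s t
  | fMem t X => fMem t (rho X)
  | fBot => fBot
  | fImp p q => fImp (renS rho p) (renS rho q)
  | fAnd p q => fAnd (renS rho p) (renS rho q)
  | fOr p q => fOr (renS rho p) (renS rho q)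
  | fAll p => fAll (renS rho p)
  | fEx p => fEx (renS rho p)
  | fAllS p => fAllS (renS (upr rho) p)
  | fExS p => fExS (renS (upr rho) p)
  end.

(** In [fBAll t p] and [fBEx t p] the bound [t] lives outside the quantifier,
    so it cannot mention the quantified variable. *)
Definition fBAll (t : term) (p : formula) : formula :=
  fAll (fImp (fLt (Var 0) (tlift t)) p).
Definition fBEx (t : term) (p : formula) : formula :=
  fEx (fAnd (fLt (Var 0) (tlift t)) p).

(** * The arithmetical hierarchy (free set variables are allowed) *)

Inductive Delta00 : formula -> Prop :=
| D_eq s t : Delta00 (fEq s t)
| D_lt s t : Delta00 (fLt s t)
| D_mem t X : Delta00 (fMem t X)
| D_bot : Delta00 fBot
| D_imp p q : Delta00 p -> Delta00 q -> Delta00 (fImp p q)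
| D_and p q : Delta00 p -> Delta00 q -> Delta00 (fAnd p q)
| D_or p q : Delta00 p -> Delta00 q -> Delta00 (fOr p q)
| D_ball t p : Delta00 p -> Delta00 (fBAll t p)
| D_bex t p : Delta00 p -> Delta00 (fBEx t p).

Inductive Sigma0 : nat -> formula -> Prop :=
| Sigma0_O p : Delta00 p -> Sigma0 0 p
| Sigma0_S n p : Pi0 n p -> Sigma0 (S n) (fEx p)
with Pi0 : nat -> formula -> Prop :=
| Pi0_O p : Delta00 p -> Pi0 0 p
| Pi0_S n p : Sigma0 n p -> Pi0 (S n) (fAll p).

(** * L_2-structures (general, i.e. Henkin, semantics) *)

Record structure : Type := Structure {
  dom : Type;
  s_zero : dom;
  s_one : dom;
  s_plus : dom -> dom -> dom;
  s_times : dom -> dom -> dom;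
  s_lt : dom -> dom -> Prop;
  s_sets : (dom -> Prop) -> Prop;
  s_sets_nonempty : exists X, s_sets X
}.

Fixpoint teval (M : structure) (e : nat -> dom M) (t : term) : dom M :=
  match t with
  | Var i => e i
  | Zero => s_zero M
  | One => s_one M
  | Plus s t => s_plus (teval e s) (teval e t)
  | Times s t => s_times (teval e s) (teval e t)
  end.

Fixpoint sat (M : structure) (e : nat -> dom M) (E : nat -> dom M -> Prop)
    (p : formula) : Prop :=
  match p with
  | fEq s t => teval e s = teval e t
  | fLt s t => s_lt (teval e s) (teval e t)
  | fMem t X => E X (teval e t)
  | fBot => False
  | fImp p q => sat e E p -> sat e E q
  | fAnd p q => sat e E p /\ sat e E q
  | fOr p q => sat e E p \/ sat e E q
  | fAll p => forall x : dom M, sat (scons x e) E p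
  | fEx p => exists x : dom M, sat (scons x e) E p
  | fAllS p => forall X : dom M -> Prop, s_sets X -> sat e (scons X E) p
  | fExS p => exists X : dom M -> Prop, s_sets X /\ sat e (scons X E) p
  end.

(** Truth of the universal closure of [p]. *)
Definition models (M : structure) (p : formula) : Prop :=
  forall (e : nat -> dom M) (E : nat -> dom M -> Prop),
    (forall i, s_sets (E i)) -> sat e E p.

(** A theory is a set of axioms, each standing for its universal closure. *)
Definition theory : Type := formula -> Prop.

Definition single (p : formula) : theory := fun q => q = p.
Definition union (T U : theory) : theory := fun p => T p \/ U p.

Definition models_theory (M : structure) (T : theory) : Prop :=
  forall p, T p -> models M p.

Definition entails (T U : theory) : Prop :=
  forall M : structure, models_theory M T -> models_theory M U.

(** [implies_over B T U]: over the base theory [B], [T] implies (every axiom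
    of) [U]. *)
Definition implies_over (B T U : theory) : Prop := entails (union B T) U.

(** * Axiom schemes *)

Inductive basic_axiom : theory :=
| ax_succ_nonzero :
    basic_axiom (fNot (fEq (Plus (Var 0) One) Zero))
| ax_succ_inj :
    basic_axiom (fImp (fEq (Plus (Var 0) One) (Plus (Var 1) One))
                      (fEq (Var 0) (Var 1)))
| ax_plus_zero :
    basic_axiom (fEq (Plus (Var 0) Zero) (Var 0))
| ax_plus_succ :
    basic_axiom (fEq (Plus (Var 0) (Plus (Var 1) One))
                     (Plus (Plus (Var 0) (Var 1)) One))
| ax_times_zero :
    basic_axiom (fEq (Times (Var 0) Zero) Zero)
| ax_times_succ :
    basic_axiom (fEq (Times (Var 0) (Plus (Var 1) One))
                     (Plus (Times (Var 0) (Var 1)) (Var 0)))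
| ax_lt_zero :
    basic_axiom (fNot (fLt (Var 0) Zero))
| ax_lt_succ :
    basic_axiom (fIff (fLt (Var 0) (Plus (Var 1) One))
                      (fOr (fLt (Var 0) (Var 1)) (fEq (Var 0) (Var 1)))).

(** The induction variable is number index 0 of [p]; all other free number and
    set variables of [p] are parameters. *)
Definition induction_for (p : formula) : formula :=
  fImp (fAnd (subst (scons Zero Var) p)
             (fAll (fImp p
                (subst (scons (Plus (Var 0) One) (fun i => Var (S i))) p))))
       (fAll p).

Inductive ISigma (n : nat) : theory :=
| ISigma_intro p : Sigma0 n p -> ISigma n (induction_for p).

(** [renS S p] is [p] seen in the scope of the new set quantifier, so that the
    set being defined is not free in it. *)
Definition comprehension_for (p q : formula) : formula :=
  fImp (fAll (fIff p q))
       (fExS (fAll (fIff (fMem (Var 0) 0) (renS S p)))).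

Inductive Delta01_CA : theory :=
| Delta01_CA_intro p q :
    Sigma0 1 p -> Pi0 1 q -> Delta01_CA (comprehension_for p q).

Definition RCA0 : theory :=
  union basic_axiom (union (ISigma 1) Delta01_CA).

(** Renaming that keeps the indices 0 and 1 and makes room for [k] new number
    variables just above them. *)
Definition skip2 (k : nat) : nat -> term :=
  scons (Var 0) (scons (Var 1) (fun i => Var (2 + k + i))).

(** For p(x, y) with y = index 0 and x = index 1:
    for all a, if (forall x < a)(exists y) p(x, y),
    then for some b, (forall x < a)(exists y < b) p(x, y). *)
Definition bounding_for (p : formula) : formula :=
  fAll (fImp (fBAll (Var 0) (fEx (subst (skip2 1) p)))
             (fEx (fBAll (Var 1) (fBEx (Var 1) (subst (skip2 2) p))))).

Inductive BPi (n : nat) : theory :=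
| BPi_intro p : Pi0 n p -> BPi n (bounding_for p).

(** * Elementary indecomposability *)

(** The pairing map (i + j)^2 + i, and left-nested tuples built from it; a
    1-tuple is its entry. *)
Definition Pair (s t : term) : term :=
  Plus (Times (Plus s t) (Plus s t)) s.

Definition tuple (l : list term) : term :=
  match l with
  | [] => Zero
  | t :: l => fold_left Pair l t
  end.

(** If n quantifiers have been passed, followed by [a] more, then
    [vars a n] = [Var (a + n - 1); ...; Var a] lists the n variables they bind,
    the outermost one first. *)
Definition vars (a n : nat) : list term := map Var (rev (seq a n)).

(** The value of the function coded by the set variable [C] at the tuple [xs]
    is [y]. *)
Definition fVal (C : nat) (xs : list term) (y : term) : formula :=
  fMem (Pair (tuple xs) y) C.

(** Number index 0 is k, set index 0 is c.  The three conjuncts say that c is a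
    subset of N^n x {0, ..., k-1}, that c is total, and that c is
    single-valued. *)
Definition is_coloring (n : nat) : formula :=
  fAnd
    (fAll (fImp (fMem (Var 0) 0)
       (Nat.iter n fEx (fEx
          (fAnd (fLt (Var 0) (Var (n + 2)))
                (fEq (Var (n + 1)) (Pair (tuple (vars 1 n)) (Var 0))))))))
  (fAnd
    (Nat.iter n fAll (fEx (fVal 0 (vars 1 n) (Var 0))))
    (Nat.iter n fAll (fAll (fAll
       (fImp (fVal 0 (vars 2 n) (Var 1))
          (fImp (fVal 0 (vars 2 n) (Var 0))
             (fEq (Var 1) (Var 0)))))))).

(** "There are infinitely many x such that p(x)": for all b there is x > b with
    p(x).  The substitution shields the parameters of [p] from b. *)
Definition fExInf (p : formula) : formula :=
  fAll (fEx (fAnd (fLt (Var 1) (Var 0))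
                  (subst (scons (Var 0) (fun i => Var (S (S i)))) p))).

Definition ElemIndec (n : nat) : formula :=
  fAll (fAllS (fImp (is_coloring n)
    (fEx (fAnd (fLt (Var 0) (Var 1))
               (Nat.iter n fExInf (fVal 0 (vars 0 n) (Var n))))))).

(* Main.v *)
(** Everything happens inside a Henkin model, where Delta_0, Sigma_n and Pi_n
    become classes of predicates on environments, relative to a set of oracles.

    (b) Let [c] be a colouring of arity [n + 1].  Starting from the Sigma_1 facts
    "there is [x > b] such that [c (_, x)] agrees with the finite set [w]", one
    iterates a low basis argument: the facts already decided define an infinite
    tree of approximations to a colouring of one argument less, each initial
    segment of which recurs for infinitely many values of the dropped argument.
    Refuting facts about this new colouring greedily decides all its Sigma_1 facts
    by a predicate that is Delta_2 in the previous one, so each of the [n] steps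
    costs one level of induction.  With no arguments left, a colour is chosen by
    compactness.

    (a) By induction on [n].  Given [forall x < a, exists y, P x y] with [P] in
    Pi_(n+1), bound the quantifiers of [P] by [s_1, ..., s_(n+1)] and colour this
    tuple by an [x < a] whose first apparent witness is as large as possible.
    Collection for Pi_n makes the approximations converge uniformly on bounded
    sets, and a true witness for an infinitely recurring colour bounds witnesses
    for all [x < a]. *)

From Stdlib Require Import List Arith Lia Classical ClassicalEpsilon
  FunctionalExtensionality PropExtensionality Ring.
Require Import Defs.
Import ListNotations.
Set Implicit Arguments.
Unset Strict Implicit.

(** The families of facts decided along the way need not be sets of the model, so they enter as
    oracles, and [Delta2_Ind] trades a Delta_2 extension of the oracles for one level of induction.
    For arity [n + 1] the budget is exact: of Sigma_(n+2) induction, one level pays for the initial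
    Sigma_1 facts and one for each of [n] projections, and the Sigma_1 induction that remains yields
    the Delta_0 collection by which a colour is chosen. Lowness is what makes this add up: a
    projection that was merely Delta_2 would have Sigma_1 facts that are Sigma_2 but perhaps not
    Delta_2, and each argument would cost a further level. Hence no colouring of fewer arguments is
    ever formed; it is present only as a consistent family of facts. A second obstacle is
    compactness. Codes of finite sets are not unique, and that every set has a code below a given
    number is a Pi_1 condition; it is kept as one more oracle, so that searches through codes stay
    bounded at every stage. *)

Lemma pred_ext (A : Type) (P Q : A -> Prop) : (forall x, P x <-> Q x) -> P = Q.
Proof.
  intros H. apply functional_extensionality. intros x.
  apply propositional_extensionality. apply H.
Qed.

(** * Substitution lemmas and the definability classes of a structure *)

Section Semantics.
Variable M : structure.
Notation D := (dom M).
Notation env := (nat -> D).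

Lemma scons_eta (e : env) : scons (e 0) (fun i => e (S i)) = e.
Proof. apply functional_extensionality. intros [|i]; reflexivity. Qed.

Lemma scons_up (x : D) (e : env) (sigma : nat -> term) :
  (fun i => teval (scons x e) (up sigma i)) = scons x (fun i => teval e (sigma i)).
Proof.
  apply functional_extensionality. intros [|i]; simpl; [reflexivity|].
  unfold tlift. generalize (sigma i). induction t; simpl; congruence.
Qed.

Lemma teval_subst (e : env) (sigma : nat -> term) (t : term) :
  teval e (tsubst sigma t) = teval (fun i => teval e (sigma i)) t.
Proof. induction t; simpl; congruence. Qed.

Lemma teval_lift (x : D) (e : env) (t : term) : teval (scons x e) (tlift t) = teval e t.
Proof. unfold tlift. rewrite teval_subst. reflexivity. Qed.

Lemma sat_subst (p : formula) : forall (e : env) E sigma,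
  sat e E (subst sigma p) <-> sat (fun i => teval e (sigma i)) E p.
Proof.
  induction p; intros e E sigma; simpl; rewrite ?teval_subst; try reflexivity.
  - now rewrite IHp1, IHp2.
  - now rewrite IHp1, IHp2.
  - now rewrite IHp1, IHp2.
  - assert (K : forall x, sat (scons x e) E (subst (up sigma) p) <->
      sat (scons x (fun i => teval e (sigma i))) E p)
      by (intros x; now rewrite IHp, scons_up).
    split; intros H x; apply K, H.
  - assert (K : forall x, sat (scons x e) E (subst (up sigma) p) <->
      sat (scons x (fun i => teval e (sigma i))) E p)
      by (intros x; now rewrite IHp, scons_up).
    split; intros [x H]; exists x; apply K, H.
  - split; intros H X HX; apply IHp; apply H; exact HX.
  - split; intros (X & HX & H); exists X; split; trivial; apply IHp; exact H.
Qed.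

Lemma sat_renS (p : formula) : forall (e : env) E rho,
  sat e E (renS rho p) <-> sat e (fun i => E (rho i)) p.
Proof.
  assert (Hup : forall (X : D -> Prop) E rho,
    (fun i => scons X E (upr rho i)) = scons X (fun i => E (rho i))).
  { intros. apply functional_extensionality. intros [|i]; reflexivity. }
  induction p; intros e E rho; simpl; try reflexivity.
  - now rewrite IHp1, IHp2.
  - now rewrite IHp1, IHp2.
  - now rewrite IHp1, IHp2.
  - split; intros H x; apply IHp; apply H.
  - split; intros [x H]; exists x; apply IHp; exact H.
  - assert (K : forall X, sat e (scons X E) (renS (upr rho) p) <->
      sat e (scons X (fun i => E (rho i))) p) by (intros X; now rewrite IHp, Hup).
    split; intros H X HX; apply K, H, HX.
  - assert (K : forall X, sat e (scons X E) (renS (upr rho) p) <->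
      sat e (scons X (fun i => E (rho i))) p) by (intros X; now rewrite IHp, Hup).
    split; intros (X & HX & H); exists X; split; trivial; apply K, H.
Qed.

(** Elements of the model occur as constants, so that every predicate below may
    have parameters; [zero] and [one] are constants as well. *)
Inductive Tm : (env -> D) -> Prop :=
| tm_var i : Tm (fun e => e i)
| tm_const c : Tm (fun _ => c)
| tm_plus f g : Tm f -> Tm g -> Tm (fun e => s_plus (f e) (g e))
| tm_times f g : Tm f -> Tm g -> Tm (fun e => s_times (f e) (g e)).

(** Three places fit the relations [N b w m] that later serve as oracles; a set of the model ignores
    the last two. Nothing requires an oracle to belong to the model. *)
Definition oracles : Type := (D -> D -> D -> Prop) -> Prop.

Inductive D0 (O : oracles) : (env -> Prop) -> Prop :=
| d_eq f g : Tm f -> Tm g -> D0 O (fun e => f e = g e)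
| d_lt f g : Tm f -> Tm g -> D0 O (fun e => s_lt (f e) (g e))
| d_mem A f g h : O A -> Tm f -> Tm g -> Tm h -> D0 O (fun e => A (f e) (g e) (h e))
| d_bot : D0 O (fun _ => False)
| d_imp P Q : D0 O P -> D0 O Q -> D0 O (fun e => P e -> Q e)
| d_and P Q : D0 O P -> D0 O Q -> D0 O (fun e => P e /\ Q e)
| d_or P Q : D0 O P -> D0 O Q -> D0 O (fun e => P e \/ Q e)
| d_ball f P : Tm f -> D0 O P -> D0 O (fun e => forall x, s_lt x (f e) -> P (scons x e))
| d_bex f P : Tm f -> D0 O P -> D0 O (fun e => exists x, s_lt x (f e) /\ P (scons x e)).

(** [hier O true n] is Sigma_n and [hier O false n] is Pi_n relative to [O]. *)
Fixpoint hier (O : oracles) (b : bool) (n : nat) (P : env -> Prop) : Prop :=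
  match n with
  | 0 => D0 O P
  | S n => exists Q, hier O (negb b) n Q /\
      P = if b then (fun e => exists x, Q (scons x e)) else (fun e => forall x, Q (scons x e))
  end.

Definition Ind (O : oracles) (n : nat) : Prop :=
  forall P : D -> Prop, hier O true n (fun e => P (e 0)) ->
  P (s_zero M) -> (forall x, P x -> P (s_plus x (s_one M))) -> forall x, P x.

Definition Coll (O : oracles) (n : nat) : Prop :=
  forall R : D -> D -> Prop, hier O false n (fun e => R (e 0) (e 1)) ->
  forall a, (forall x, s_lt x a -> exists y, R x y) ->
  exists b, forall x, s_lt x a -> exists y, s_lt y b /\ R x y.

Definition set_oracles : oracles :=
  fun A => exists X, s_sets X /\ A = fun x _ _ => X x.

Lemma Tm_subst f : Tm f -> forall ts : nat -> env -> D, (forall i, Tm (ts i)) ->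
  Tm (fun e => f (fun i => ts i e)).
Proof. induction 1; intros ts Hts; try (constructor; auto). apply Hts. Qed.

Definition lift_ts (ts : nat -> env -> D) : nat -> env -> D :=
  scons (fun e => e 0) (fun i e => ts i (fun j => e (S j))).

Lemma Tm_lift_ts ts : (forall i, Tm (ts i)) -> forall i, Tm (lift_ts ts i).
Proof.
  intros H [|i]; simpl.
  - exact (tm_var 0).
  - exact (Tm_subst (H i) (fun j => tm_var (S j))).
Qed.

Lemma lift_ts_scons ts x e :
  (fun i => lift_ts ts i (scons x e)) = scons x (fun i => ts i e).
Proof. apply functional_extensionality. intros [|i]; reflexivity. Qed.

Lemma D0_subst O P : D0 O P -> forall ts : nat -> env -> D, (forall i, Tm (ts i)) ->
  D0 O (fun e => P (fun i => ts i e)).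
Proof.
  induction 1; intros ts Hts.
  - exact (d_eq O (Tm_subst H Hts) (Tm_subst H0 Hts)).
  - exact (d_lt O (Tm_subst H Hts) (Tm_subst H0 Hts)).
  - exact (d_mem H (Tm_subst H0 Hts) (Tm_subst H1 Hts) (Tm_subst H2 Hts)).
  - apply d_bot.
  - exact (d_imp (IHD0_1 ts Hts) (IHD0_2 ts Hts)).
  - exact (d_and (IHD0_1 ts Hts) (IHD0_2 ts Hts)).
  - exact (d_or (IHD0_1 ts Hts) (IHD0_2 ts Hts)).
  - pose proof (d_ball (Tm_subst H Hts) (IHD0 _ (Tm_lift_ts Hts))) as K.
    erewrite pred_ext; [exact K|]. intros e; cbv beta.
    split; intros G x Hx; specialize (G x Hx); rewrite lift_ts_scons in *; exact G.
  - pose proof (d_bex (Tm_subst H Hts) (IHD0 _ (Tm_lift_ts Hts))) as K.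
    erewrite pred_ext; [exact K|]. intros e; cbv beta.
    split; intros (x & Hx & G); exists x; rewrite lift_ts_scons in *; auto.
Qed.

(** [Q] is a pattern here, so that [apply] goes under the quantifier. *)
Lemma d_ball' O f Q : Tm f -> D0 O (fun e => Q (e 0) (fun i => e (S i))) ->
  D0 O (fun e => forall x, s_lt x (f e) -> Q x e).
Proof. intros Hf HQ. exact (d_ball Hf HQ). Qed.

Lemma d_bex' O f Q : Tm f -> D0 O (fun e => Q (e 0) (fun i => e (S i))) ->
  D0 O (fun e => exists x, s_lt x (f e) /\ Q x e).
Proof. intros Hf HQ. exact (d_bex Hf HQ). Qed.

Lemma d_iff O P Q : D0 O P -> D0 O Q -> D0 O (fun e => P e <-> Q e).
Proof. intros. apply d_and; apply d_imp; assumption. Qed.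

Lemma hier_ext O b n (P Q : env -> Prop) :
  hier O b n P -> (forall e, P e <-> Q e) -> hier O b n Q.
Proof. intros H E. rewrite <- (pred_ext E). exact H. Qed.

Lemma hier_ex O n (Q : D -> env -> Prop) :
  hier O false n (fun e => Q (e 0) (fun i => e (S i))) ->
  hier O true (S n) (fun e => exists x, Q x e).
Proof. intros H. eexists. split; [exact H|]. reflexivity. Qed.

Lemma hier_all O n (Q : D -> env -> Prop) :
  hier O true n (fun e => Q (e 0) (fun i => e (S i))) ->
  hier O false (S n) (fun e => forall x, Q x e).
Proof. intros H. eexists. split; [exact H|]. reflexivity. Qed.

(** [under j F] acts by [F] below [j] bound variables. *)
Fixpoint under (j : nat) (F : env -> env) : env -> env :=
  match j with
  | 0 => F
  | S j => fun e => scons (e 0) (under j F (fun i => e (S i)))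
  end.

Lemma under_comm j F : under j (under 1 F) = under (S j) F.
Proof.
  induction j; [reflexivity|].
  change (under (S j) (under 1 F)) with
    (fun e : env => scons (e 0) (under j (under 1 F) (fun i => e (S i)))).
  rewrite IHj. reflexivity.
Qed.

(** Unpairing is not a term, so term substitution does not cover it. Closure is demanded below any
    number [j] of binders, because in [hier_pull] the transformation ends up inside the whole
    quantifier prefix. *)
Definition admissible O (F : env -> env) : Prop :=
  forall P, D0 O P -> forall j, D0 O (fun e => P (under j F e)).

Lemma hier_pull O n : forall b P F, hier O b n P -> admissible O F ->
  hier O b n (fun e => P (F e)).
Proof.
  induction n as [|n IH]; intros b P F H HF.
  - exact (HF P H 0).
  - destruct H as (Q & HQ & ->).
    assert (HF' : admissible O (under 1 F)).
    { intros R HR j. rewrite under_comm. exact (HF R HR (S j)). }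
    exists (fun e => Q (under 1 F e)). split; [exact (IH _ _ _ HQ HF')|].
    destruct b; reflexivity.
Qed.

Lemma hier_subst O n b P (ts : nat -> env -> D) : hier O b n P -> (forall i, Tm (ts i)) ->
  hier O b n (fun e => P (fun i => ts i e)).
Proof.
  intros H Hts. apply (hier_pull (F := fun e i => ts i e) H).
  intros Q HQ j.
  assert (exists ts', (forall i, Tm (ts' i)) /\
    forall e, under j (fun e i => ts i e) e = fun i => ts' i e) as (ts' & H' & E).
  { induction j as [|j (ts' & H' & E)].
    - exists ts. auto.
    - exists (lift_ts ts'). split; [apply Tm_lift_ts, H'|].
      intros e. simpl. rewrite E. rewrite <- lift_ts_scons, scons_eta. reflexivity. }
  erewrite pred_ext; [exact (D0_subst HQ H')|].
  intros e; cbv beta. now rewrite E.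
Qed.

Lemma hier_1 O n b (P : D -> Prop) f : hier O b n (fun e => P (e 0)) -> Tm f ->
  hier O b n (fun e => P (f e)).
Proof. intros H Hf. apply (hier_subst (ts := fun _ => f) H). auto. Qed.

Lemma hier_2 O n b (P : D -> D -> Prop) f g : hier O b n (fun e => P (e 0) (e 1)) ->
  Tm f -> Tm g -> hier O b n (fun e => P (f e) (g e)).
Proof.
  intros H Hf Hg. apply (hier_subst (ts := scons f (fun _ => g)) H). now intros [|i].
Qed.

Lemma hier_3 O n b (P : D -> D -> D -> Prop) f g h :
  hier O b n (fun e => P (e 0) (e 1) (e 2)) ->
  Tm f -> Tm g -> Tm h -> hier O b n (fun e => P (f e) (g e) (h e)).
Proof.
  intros H Hf Hg Hh.
  apply (hier_subst (ts := scons f (scons g (fun _ => h))) H). now intros [|[|i]].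
Qed.

(** The strictly alternating prefix is padded by vacuous quantifiers, which are harmless because
    [s_zero M] inhabits the domain. *)
Lemma D0_hier O n : forall b P, D0 O P -> hier O b n P.
Proof.
  induction n as [|n IH]; intros b P H; [exact H|].
  exists (fun e => P (fun i => e (S i))). split.
  - apply IH. exact (D0_subst H (fun i => tm_var (S i))).
  - apply pred_ext. intros e. destruct b; split; intros K.
    + exists (s_zero M). exact K.
    + destruct K as [x G]. exact G.
    + intros x. exact K.
    + exact (K (s_zero M)).
Qed.

Lemma hier_S O n : forall b P, hier O b n P -> hier O b (S n) P.
Proof.
  induction n as [|n IH]; intros b P H; [now apply D0_hier|].
  destruct H as (Q & HQ & ->). exists Q. auto.
Qed.

Lemma hier_dual O n b P : hier O b n P -> hier O (negb b) (S n) P.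
Proof.
  intros H. exists (fun e => P (fun i => e (S i))). split.
  - rewrite Bool.negb_involutive. exact (hier_subst H (fun i => tm_var (S i))).
  - apply pred_ext. intros e. destruct b; split; intros K.
    + intros x. exact K.
    + exact (K (s_zero M)).
    + exists (s_zero M). exact K.
    + destruct K as [x G]. exact G.
Qed.

Lemma hier_le O n m b P : n <= m -> hier O b n P -> hier O b m P.
Proof. induction 1; auto. intros K. apply hier_S; auto. Qed.

Lemma hier_not O n : forall b P, hier O (negb b) n P -> hier O b n (fun e => ~ P e).
Proof.
  induction n as [|n IH]; intros b P H.
  - apply d_imp; [exact H|apply d_bot].
  - destruct H as (Q & HQ & ->). exists (fun e => ~ Q e). split; [auto|].
    apply pred_ext. intros e. destruct b; simpl; split.
    + apply not_all_ex_not.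
    + intros [x K] G. exact (K (G x)).
    + intros K x G. apply K. exists x. exact G.
    + intros K [x G]. exact (K x G).
Qed.

Lemma D0_mono (O O' : oracles) P : (forall A, O A -> O' A) -> D0 O P -> D0 O' P.
Proof. intros HO. induction 1; try (constructor; auto; fail). Qed.

Lemma hier_mono (O O' : oracles) n : (forall A, O A -> O' A) ->
  forall b P, hier O b n P -> hier O' b n P.
Proof.
  intros HO. induction n as [|n IH]; intros b P H; [exact (D0_mono HO H)|].
  destruct H as (Q & HQ & E). exists Q. auto.
Qed.

Lemma Ind_mono (O O' : oracles) n : (forall A, O A -> O' A) -> Ind O' n -> Ind O n.
Proof. intros HO H P HP. apply H. exact (hier_mono HO HP). Qed.

Lemma Ind_le O n m : n <= m -> Ind O m -> Ind O n.
Proof. intros L H P HP. apply H. exact (hier_le L HP). Qed.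

Lemma Coll_le O n m : n <= m -> Coll O m -> Coll O n.
Proof. intros L H P HP. apply H. exact (hier_le L HP). Qed.

(** * From predicates to formulas *)

(** Formulas have no constants for elements. A predicate with parameters is therefore a formula read
    through [v], which sends each free variable either to an index of the environment or to a fixed
    element. *)
Definition look (v : nat -> nat + D) (e : env) (i : nat) : D :=
  match v i with inl j => e j | inr c => c end.

(** Two formulas with unrelated assignments are put side by side by moving the variables of one to
    even and of the other to odd indices; this serves number and set variables alike. *)
Definition zip (A : Type) (v1 v2 : nat -> A) (i : nat) : A :=
  if Nat.even i then v1 (Nat.div2 i) else v2 (Nat.div2 i).

Lemma zip_even (A : Type) (v1 v2 : nat -> A) i : zip v1 v2 (2 * i) = v1 i.
Proof. unfold zip. now rewrite Nat.even_even, Nat.div2_even. Qed.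

Lemma zip_odd (A : Type) (v1 v2 : nat -> A) i : zip v1 v2 (S (2 * i)) = v2 i.
Proof.
  unfold zip. rewrite Nat.div2_succ_double.
  replace (S (2 * i)) with (2 * i + 1) by lia. now rewrite Nat.even_odd.
Qed.

Lemma look_left v1 v2 e : (fun i => look (zip v1 v2) e (2 * i)) = look v1 e.
Proof. apply functional_extensionality. intros i. unfold look. now rewrite zip_even. Qed.

Lemma look_right v1 v2 e : (fun i => look (zip v1 v2) e (S (2 * i))) = look v2 e.
Proof. apply functional_extensionality. intros i. unfold look. now rewrite zip_odd. Qed.

Definition tm_left := tsubst (fun i => Var (2 * i)).
Definition tm_right := tsubst (fun i => Var (S (2 * i))).

Lemma teval_left v1 v2 e t : teval (look (zip v1 v2) e) (tm_left t) = teval (look v1 e) t.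
Proof. unfold tm_left. rewrite teval_subst. now rewrite <- (look_left v1 v2). Qed.

Lemma teval_right v1 v2 e t : teval (look (zip v1 v2) e) (tm_right t) = teval (look v2 e) t.
Proof. unfold tm_right. rewrite teval_subst. now rewrite <- (look_right v1 v2). Qed.

Definition fm_left p := renS (fun i => 2 * i) (subst (fun i => Var (2 * i)) p).
Definition fm_right p := renS (fun i => S (2 * i)) (subst (fun i => Var (S (2 * i))) p).

Lemma sat_left v1 v2 e E1 E2 p :
  sat (look (zip v1 v2) e) (zip E1 E2) (fm_left p) <-> sat (look v1 e) E1 p.
Proof.
  unfold fm_left. rewrite sat_renS, sat_subst. simpl teval.
  change (fun i => look (zip v1 v2) e (i + (i + 0))) with (fun i => look (zip v1 v2) e (2 * i)).
  rewrite look_left.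
  replace (fun i => zip E1 E2 (2 * i)) with E1; [reflexivity|].
  apply functional_extensionality. intros i. now rewrite zip_even.
Qed.

Lemma sat_right v1 v2 e E1 E2 p :
  sat (look (zip v1 v2) e) (zip E1 E2) (fm_right p) <-> sat (look v2 e) E2 p.
Proof.
  unfold fm_right. rewrite sat_renS, sat_subst. simpl teval.
  change (fun i => look (zip v1 v2) e (S (i + (i + 0)))) with
    (fun i => look (zip v1 v2) e (S (2 * i))).
  rewrite look_right.
  replace (fun i => zip E1 E2 (S (2 * i))) with E2; [reflexivity|].
  apply functional_extensionality. intros i. now rewrite zip_odd.
Qed.

Lemma zip_sets E1 E2 : (forall i, s_sets (E1 i)) -> (forall i, @s_sets M (E2 i)) ->
  forall i, s_sets (zip E1 E2 i).
Proof. intros H1 H2 i. unfold zip. destruct (Nat.even i); auto. Qed.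

Lemma tsubst_lift sigma t : tsubst (up sigma) (tlift t) = tlift (tsubst sigma t).
Proof. induction t; try reflexivity; unfold tlift in *; simpl; congruence. Qed.

Lemma Delta00_subst p : Delta00 p -> forall sigma, Delta00 (subst sigma p).
Proof.
  induction 1; intros sigma; try (simpl; constructor; auto; fail).
  - change (Delta00 (fAll (fImp (fLt (Var 0) (tsubst (up sigma) (tlift t)))
      (subst (up sigma) p)))).
    rewrite tsubst_lift. apply D_ball. auto.
  - change (Delta00 (fEx (fAnd (fLt (Var 0) (tsubst (up sigma) (tlift t)))
      (subst (up sigma) p)))).
    rewrite tsubst_lift. apply D_bex. auto.
Qed.

Lemma Delta00_renS p : Delta00 p -> forall rho, Delta00 (renS rho p).
Proof.
  induction 1; intros rho; simpl; constructor; auto.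
Qed.

Definition level (b : bool) (n : nat) (p : formula) : Prop :=
  if b then Sigma0 n p else Pi0 n p.

Lemma level_subst n : forall b p sigma, level b n p -> level b n (subst sigma p).
Proof.
  induction n as [|n IH]; intros b p sigma H.
  - destruct b; inversion H; subst; constructor; now apply Delta00_subst.
  - destruct b; inversion H; subst; simpl; constructor.
    + now apply (IH false).
    + now apply (IH true).
Qed.

(** Several variables may stand for index 0 of the environment; binding that index
    has to merge them into one bound variable. *)
Definition bind (v : nat -> nat + D) (i : nat) : term :=
  match v i with inl 0 => Var 0 | _ => Var (S i) end.
Definition unbind (v : nat -> nat + D) (i : nat) : nat + D :=
  match v i with inl 0 => inr (s_zero M) | inl (S j) => inl j | inr c => inr c end.

Lemma sat_bind v E x e p :
  sat (scons x (look (unbind v) e)) E (subst (bind v) p) <-> sat (look v (scons x e)) E p.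
Proof.
  rewrite sat_subst.
  replace (fun i => teval (scons x (look (unbind v) e)) (bind v i)) with (look v (scons x e));
    [reflexivity|].
  apply functional_extensionality. intros i. unfold look, bind, unbind.
  destruct (v i) as [[|j]|c] eqn:Ev; simpl; rewrite ?Ev; reflexivity.
Qed.

Lemma Tm_term f : Tm f -> exists t v, forall e, f e = teval (look v e) t.
Proof.
  induction 1 as [i|c|f g Hf (t1 & v1 & H1) Hg (t2 & v2 & H2)
                     |f g Hf (t1 & v1 & H1) Hg (t2 & v2 & H2)].
  - exists (Var i), inl. reflexivity.
  - exists (Var 0), (fun _ => inr c). reflexivity.
  - exists (Plus (tm_left t1) (tm_right t2)), (zip v1 v2). intros e. simpl.
    rewrite teval_left, teval_right. congruence.
  - exists (Times (tm_left t1) (tm_right t2)), (zip v1 v2). intros e. simpl.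
    rewrite teval_left, teval_right. congruence.
Qed.

Lemma D0_formula P : D0 set_oracles P -> exists p E v, Delta00 p /\
  (forall i, s_sets (E i)) /\ forall e, P e <-> sat (look v e) E p.
Proof.
  destruct (s_sets_nonempty M) as [X0 HX0].
  induction 1 as [f g Hf Hg|f g Hf Hg|A f g h HA Hf Hg Hh|
    |P Q HP (p1 & E1 & v1 & D1 & S1 & H1) HQ (p2 & E2 & v2 & D2 & S2 & H2)
    |P Q HP (p1 & E1 & v1 & D1 & S1 & H1) HQ (p2 & E2 & v2 & D2 & S2 & H2)
    |P Q HP (p1 & E1 & v1 & D1 & S1 & H1) HQ (p2 & E2 & v2 & D2 & S2 & H2)
    |f P Hf HP (p & E & v & Dp & SE & H)|f P Hf HP (p & E & v & Dp & SE & H)].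
  - destruct (Tm_term Hf) as (t1 & v1 & H1), (Tm_term Hg) as (t2 & v2 & H2).
    exists (fEq (tm_left t1) (tm_right t2)), (fun _ => X0), (zip v1 v2).
    split; [constructor|]. split; [auto|]. intros e. simpl.
    now rewrite teval_left, teval_right, H1, H2.
  - destruct (Tm_term Hf) as (t1 & v1 & H1), (Tm_term Hg) as (t2 & v2 & H2).
    exists (fLt (tm_left t1) (tm_right t2)), (fun _ => X0), (zip v1 v2).
    split; [constructor|]. split; [auto|]. intros e. simpl.
    now rewrite teval_left, teval_right, H1, H2.
  - destruct HA as (X & HX & ->). destruct (Tm_term Hf) as (t & v & H).
    exists (fMem t 0), (fun _ => X), v.
    split; [constructor|]. split; [auto|]. intros e. simpl. now rewrite H.
  - exists fBot, (fun _ => X0), inl. split; [constructor|]. split; [auto|]. reflexivity.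
  - exists (fImp (fm_left p1) (fm_right p2)), (zip E1 E2), (zip v1 v2).
    split; [constructor; now apply Delta00_renS, Delta00_subst|].
    split; [now apply zip_sets|]. intros e. simpl.
    now rewrite sat_left, sat_right, H1, H2.
  - exists (fAnd (fm_left p1) (fm_right p2)), (zip E1 E2), (zip v1 v2).
    split; [constructor; now apply Delta00_renS, Delta00_subst|].
    split; [now apply zip_sets|]. intros e. simpl.
    now rewrite sat_left, sat_right, H1, H2.
  - exists (fOr (fm_left p1) (fm_right p2)), (zip E1 E2), (zip v1 v2).
    split; [constructor; now apply Delta00_renS, Delta00_subst|].
    split; [now apply zip_sets|]. intros e. simpl.
    now rewrite sat_left, sat_right, H1, H2.
  - destruct (Tm_term Hf) as (t & w & Ht).
    (* The bound lives on the odd indices of [u], the body on the even ones. Under the new binder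
       the even index [2 * i] has become [S (2 * i)], which explains the second substitution. *)
    pose (u := zip (unbind v) w).
    exists (fBAll (tm_right t) (subst (scons (Var 0) (fun i => Var (S (2 * i))))
       (subst (bind v) p))), E, u.
    split; [apply D_ball; now apply Delta00_subst, Delta00_subst|]. split; [auto|].
    intros e. unfold fBAll; simpl sat.
    assert (K : forall x, P (scons x e) <->
      sat (scons x (look u e)) E (subst (scons (Var 0) (fun i => Var (S (2 * i))))
       (subst (bind v) p))).
    { intros x. rewrite sat_subst.
      replace (fun i => teval (scons x (look u e)) (scons (Var 0) (fun i => Var (S (2 * i))) i))
        with (scons x (look (unbind v) e)).
      - now rewrite sat_bind.
      - apply functional_extensionality. intros [|i]; [reflexivity|].
        unfold u. rewrite <- (look_left (unbind v) w). reflexivity. }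
    split; intros G x; specialize (G x); rewrite ?teval_lift in *;
      unfold u in *; rewrite ?teval_right, <- ?Ht in *; intros Hx; apply K; auto.
  - destruct (Tm_term Hf) as (t & w & Ht).
    pose (u := zip (unbind v) w).
    exists (fBEx (tm_right t) (subst (scons (Var 0) (fun i => Var (S (2 * i))))
       (subst (bind v) p))), E, u.
    split; [apply D_bex; now apply Delta00_subst, Delta00_subst|]. split; [auto|].
    intros e. unfold fBEx; simpl sat.
    assert (K : forall x, P (scons x e) <->
      sat (scons x (look u e)) E (subst (scons (Var 0) (fun i => Var (S (2 * i))))
       (subst (bind v) p))).
    { intros x. rewrite sat_subst.
      replace (fun i => teval (scons x (look u e)) (scons (Var 0) (fun i => Var (S (2 * i))) i))
        with (scons x (look (unbind v) e)).
      - now rewrite sat_bind.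
      - apply functional_extensionality. intros [|i]; [reflexivity|].
        unfold u. rewrite <- (look_left (unbind v) w). reflexivity. }
    split; intros (x & Hx & G); exists x; rewrite ?teval_lift in *;
      unfold u in *; rewrite ?teval_right, <- ?Ht in *; split; trivial; apply K; auto.
Qed.

Lemma hier_formula n : forall b P, hier set_oracles b n P -> exists p E v, level b n p /\
  (forall i, s_sets (E i)) /\ forall e, P e <-> sat (look v e) E p.
Proof.
  induction n as [|n IH]; intros b P H.
  - destruct (D0_formula H) as (p & E & v & Dp & R). exists p, E, v.
    split; [destruct b; now constructor|exact R].
  - destruct H as (Q & HQ & ->). destruct (IH _ _ HQ) as (p & E & v & Dp & SE & R).
    exists ((if b then fEx else fAll) (subst (bind v) p)), E, (unbind v).
    split; [|split; [exact SE|]].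
    + destruct b; constructor; [now apply (level_subst (b:=false))|now apply (level_subst (b:=true))].
    + intros e. destruct b; simpl.
      * split; intros [x G]; exists x; [apply sat_bind, R|apply R, sat_bind]; exact G.
      * split; intros G x; [apply sat_bind, R|apply R, sat_bind]; exact (G x).
Qed.

Lemma hier_formula_unary n b (P : D -> Prop) : hier set_oracles b n (fun e => P (e 0)) ->
  exists p E e, level b n p /\ (forall i, s_sets (E i)) /\ forall x, P x <-> sat (scons x e) E p.
Proof.
  intros H. destruct (hier_formula H) as (p & E & v & L & SE & R).
  (* Only index 0 of the environment matters to [P]; the others are filled with [s_zero M]. *)
  exists (subst (bind v) p), E, (look (unbind v) (fun _ => s_zero M)).
  split; [now apply level_subst|]. split; [exact SE|].
  intros x. rewrite sat_bind, <- R. reflexivity.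
Qed.

Lemma models_Ind n : models_theory M (ISigma n) -> Ind set_oracles n.
Proof.
  intros HM P HP H0 HS.
  destruct (hier_formula_unary HP) as (p & E & e & L & SE & R).
  pose proof (HM _ (ISigma_intro L) e E SE) as K. simpl in K.
  intros x. apply R. apply K. split.
  - apply sat_subst. apply R in H0.
    replace (fun i => teval e (scons Zero Var i)) with (scons (s_zero M) e); [exact H0|].
    apply functional_extensionality. now intros [|i].
  - intros y Hy. apply sat_subst. apply R in Hy. apply HS, R in Hy.
    replace (fun i => teval (scons y e) (scons (Plus (Var 0) One) (fun i => Var (S i)) i))
      with (scons (s_plus y (s_one M)) e); [exact Hy|].
    apply functional_extensionality. now intros [|i].
Qed.

Lemma models_set (P : D -> Prop) : models_theory M Delta01_CA ->
  D0 set_oracles (fun e => P (e 0)) -> s_sets P.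
Proof.
  intros HM HP.
  destruct (hier_formula_unary (n := 0) (b := true) HP) as (p & E & e & L & SE & R).
  assert (Dp : Delta00 p) by now inversion L.
  (* Making room for a vacuous variable turns the Delta_0 formula into a Sigma_1 and a Pi_1 form at
     once. *)
  pose (q := subst (fun i => Var (S i)) p).
  assert (Dq : Delta00 q) by now apply Delta00_subst.
  assert (Hq : forall x e, sat (scons x e) E q <-> sat e E p).
  { intros x e'. unfold q. rewrite sat_subst. reflexivity. }
  pose proof (HM _ (Delta01_CA_intro (Sigma0_S (Pi0_O Dq)) (Pi0_S (Sigma0_O Dq))) e E SE) as K.
  simpl in K. destruct K as (X & HX & K).
  - intros x. split; intros G.
    + intros y. apply Hq. destruct G as [z G]. apply Hq in G. exact G.
    + exists x. apply Hq. specialize (G x). apply Hq in G. exact G.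
  - replace P with X; [exact HX|]. apply pred_ext. intros x. rewrite R.
    destruct (K x) as [K1 K2]. split; intros G.
    + destruct (K1 G) as [z G']. apply sat_renS, Hq in G'. exact G'.
    + apply K2. exists x. apply sat_renS, Hq. exact G.
Qed.

(** * From formulas to predicates *)

Lemma Tm_teval t : Tm (fun e => teval e t).
Proof. induction t; simpl; try (constructor; auto). Qed.

Lemma formula_D0 p E : Delta00 p -> (forall i, s_sets (E i)) ->
  D0 set_oracles (fun e => sat e E p).
Proof.
  intros Dp SE. induction Dp; simpl.
  - apply d_eq; apply Tm_teval.
  - apply d_lt; apply Tm_teval.
  - refine (d_mem (A := fun x _ _ => E X x) _ (Tm_teval t) (tm_var 0) (tm_var 0)).
    exists (E X). auto.
  - apply d_bot.
  - now apply d_imp.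
  - now apply d_and.
  - now apply d_or.
  - refine (eq_ind_r _ (d_ball (Tm_teval t) IHDp) (pred_ext _)).
    intros e. now setoid_rewrite teval_lift.
  - refine (eq_ind_r _ (d_bex (Tm_teval t) IHDp) (pred_ext _)).
    intros e. now setoid_rewrite teval_lift.
Qed.

Lemma formula_hier E n : (forall i, s_sets (E i)) -> forall b p, level b n p ->
  hier set_oracles b n (fun e => sat e E p).
Proof.
  intros SE. induction n as [|n IH]; intros b p L.
  - apply formula_D0; [|exact SE]. destruct b; now inversion L.
  - destruct b; inversion L; subst.
    + exact (hier_ex (Q := fun x e => sat (scons x e) E p0)
        (eq_ind_r (fun F => hier set_oracles false n F) (IH false _ H0)
          (pred_ext (fun e => eq_ind_r (fun e' => sat e' E p0 <-> _) (iff_refl _) (scons_eta e))))).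
    + exact (hier_all (Q := fun x e => sat (scons x e) E p0)
        (eq_ind_r (fun F => hier set_oracles true n F) (IH true _ H0)
          (pred_ext (fun e => eq_ind_r (fun e' => sat e' E p0 <-> _) (iff_refl _) (scons_eta e))))).
Qed.

End Semantics.

Arguments tm_var {M} i%_nat_scope.
Arguments tm_const {M} c.
Ltac tm := cbv beta; repeat first
  [ apply tm_const | apply tm_var | apply tm_plus | apply tm_times ].

(** [def] proves Delta_0 definability by following the shape of the predicate; the hook is redefined
    whenever a new predicate is known to be Delta_0. *)
Ltac def_hook := fail.

Ltac def := cbv beta; match goal with
  | |- Tm _ => tm
  | |- _ => first
    [ def_hook
    | apply d_bot
    | apply d_iff | apply d_and | apply d_or
    | apply d_ball' | apply d_bex' | apply d_imp
    | apply d_eq | apply d_lt ]; def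
  end.

(** * Arithmetic from Sigma_1 induction without oracles *)

Definition no_oracles (M : structure) : oracles M := fun _ => False.

Class arith (M : structure) : Prop := Arith {
  arith_basic : models_theory M basic_axiom;
  arith_ind : Ind (no_oracles (M := M)) 1
}.

Section Arithmetic.
Variable M : structure.
Context {HM : arith M}.
Notation D := (dom M).
Notation env := (nat -> D).
Declare Scope dom_scope.
Local Open Scope dom_scope.
Local Notation "0" := (s_zero M) : dom_scope.
Local Notation "1" := (s_one M) : dom_scope.
Local Infix "+" := (@s_plus M) : dom_scope.
Local Infix "*" := (@s_times M) : dom_scope.
Local Infix "<" := (@s_lt M) : dom_scope.

Lemma axiom_sat p (e : env) : basic_axiom p -> exists E, sat e E p.
Proof.
  intros Hp. destruct (s_sets_nonempty M) as [X HX].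
  exists (fun _ => X). apply arith_basic; auto.
Qed.

Lemma succ_nonzero x : x + 1 <> 0.
Proof. destruct (axiom_sat (fun _ => x) ax_succ_nonzero) as [E H]. exact H. Qed.

Lemma succ_inj x y : x + 1 = y + 1 -> x = y.
Proof. destruct (axiom_sat (scons x (fun _ => y)) ax_succ_inj) as [E H]. exact H. Qed.

Lemma add_0_r x : x + 0 = x.
Proof. destruct (axiom_sat (fun _ => x) ax_plus_zero) as [E H]. exact H. Qed.

Lemma add_succ_r x y : x + (y + 1) = (x + y) + 1.
Proof. destruct (axiom_sat (scons x (fun _ => y)) ax_plus_succ) as [E H]. exact H. Qed.

Lemma mul_0_r x : x * 0 = 0.
Proof. destruct (axiom_sat (fun _ => x) ax_times_zero) as [E H]. exact H. Qed.

Lemma mul_succ_r x y : x * (y + 1) = x * y + x.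
Proof. destruct (axiom_sat (scons x (fun _ => y)) ax_times_succ) as [E H]. exact H. Qed.

Lemma nlt_0_r x : ~ x < 0.
Proof. destruct (axiom_sat (fun _ => x) ax_lt_zero) as [E H]. exact H. Qed.

Lemma lt_succ x y : x < y + 1 <-> x < y \/ x = y.
Proof. destruct (axiom_sat (scons x (fun _ => y)) ax_lt_succ) as [E H]. exact H. Qed.

Lemma ind0 (P : D -> Prop) : D0 (no_oracles (M := M)) (fun e => P (e 0%nat)) ->
  P 0 -> (forall x, P x -> P (x + 1)) -> forall x, P x.
Proof. intros H. apply arith_ind. now apply D0_hier. Qed.

Lemma add_0_l x : 0 + x = x.
Proof.
  pattern x. apply ind0; [def| |].
  - apply add_0_r.
  - intros y H. now rewrite add_succ_r, H.
Qed.

Lemma add_succ_l x y : (x + 1) + y = (x + y) + 1.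
Proof.
  pattern y. apply ind0; [def| |].
  - now rewrite !add_0_r.
  - intros z H. now rewrite !add_succ_r, H.
Qed.

Lemma add_comm x y : x + y = y + x.
Proof.
  pattern y. apply ind0; [def| |].
  - now rewrite add_0_r, add_0_l.
  - intros z H. now rewrite add_succ_r, add_succ_l, H.
Qed.

Lemma add_assoc x y z : x + (y + z) = (x + y) + z.
Proof.
  pattern z. apply ind0; [def| |].
  - now rewrite !add_0_r.
  - intros w H. now rewrite !add_succ_r, H.
Qed.

Lemma mul_0_l x : 0 * x = 0.
Proof.
  pattern x. apply ind0; [def| |].
  - apply mul_0_r.
  - intros y H. now rewrite mul_succ_r, H, add_0_r.
Qed.

Lemma mul_succ_l x y : (x + 1) * y = x * y + y.
Proof.
  pattern y. apply ind0; [def| |].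
  - now rewrite !mul_0_r, add_0_r.
  - intros z H. rewrite !mul_succ_r, H, !add_succ_r.
    f_equal. now rewrite <- !add_assoc, (add_comm z x).
Qed.

Lemma mul_comm x y : x * y = y * x.
Proof.
  pattern y. apply ind0; [def| |].
  - now rewrite mul_0_r, mul_0_l.
  - intros z H. now rewrite mul_succ_r, mul_succ_l, H.
Qed.

Lemma mul_add_r x y z : x * (y + z) = x * y + x * z.
Proof.
  pattern z. apply ind0; [def| |].
  - now rewrite mul_0_r, !add_0_r.
  - intros w H. now rewrite add_succ_r, !mul_succ_r, H, add_assoc.
Qed.

Lemma mul_add_l x y z : (x + y) * z = x * z + y * z.
Proof. now rewrite mul_comm, mul_add_r, (mul_comm z x), (mul_comm z y). Qed.

Lemma mul_assoc x y z : x * (y * z) = (x * y) * z.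
Proof.
  pattern z. apply ind0; [def| |].
  - now rewrite !mul_0_r.
  - intros w H. now rewrite !mul_succ_r, mul_add_r, H.
Qed.

Lemma mul_1_l x : 1 * x = x.
Proof. now rewrite <- (add_0_l 1), mul_succ_l, mul_0_l, add_0_l. Qed.

Lemma dom_semiring : semi_ring_theory 0 1 (@s_plus M) (@s_times M) (@eq D).
Proof.
  constructor; intros; auto using add_0_l, add_comm, add_assoc, mul_1_l, mul_0_l, mul_comm,
    mul_assoc, mul_add_l.
Qed.

Add Ring dom_ring : dom_semiring.

Lemma add_cancel_r x y z : x + z = y + z -> x = y.
Proof.
  pattern z. apply ind0; [def| |].
  - now rewrite !add_0_r.
  - intros w IH H. apply IH, succ_inj. now rewrite <- !add_succ_r.
Qed.

Lemma add_cancel_l x y z : z + x = z + y -> x = y.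
Proof. rewrite !(add_comm z). apply add_cancel_r. Qed.

Lemma zero_or_succ x : x = 0 \/ exists y, x = y + 1.
Proof.
  (* The bound on [y] keeps the induction predicate Delta_0. *)
  assert (H : forall x, x = 0 \/ exists y, y < x + 1 /\ x = y + 1).
  { apply ind0; [def| |].
    - now left.
    - intros y _. right. exists y. split; [|reflexivity].
      apply lt_succ. left. apply lt_succ. now right. }
  destruct (H x) as [?|(y & _ & ?)]; eauto.
Qed.

Lemma add_eq_0 x y : x + y = 0 -> x = 0 /\ y = 0.
Proof.
  intros H. destruct (zero_or_succ y) as [->|[z ->]].
  - now rewrite add_0_r in H.
  - rewrite add_succ_r in H. now apply succ_nonzero in H.
Qed.

Lemma lt_iff x y : x < y <-> exists z, x + z + 1 = y.
Proof.
  split.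
  (* The quantifier is moved in front of the implication, so that the predicate is literally
     Sigma_1; when [x < y] fails, any [z] will do. *)
  - assert (H : exists z, x < y -> x + z + 1 = y).
    { pattern y. apply arith_ind.
      - apply (hier_ex (Q := fun z e => x < e 0%nat -> x + z + 1 = e 0%nat)). simpl. def.
      - exists 0. intros H. now apply nlt_0_r in H.
      - intros w [z IH]. destruct (classic (x < w)) as [L|L].
        + exists (z + 1). intros _. rewrite <- (IH L). ring.
        + exists 0. intros H. apply lt_succ in H as [H| ->]; [easy|ring]. }
    destruct H as [z H]. eauto.
  - intros [z <-]. pattern z. apply ind0; [def| |].
    + apply lt_succ. right. ring.
    + intros w H. rewrite add_assoc. apply lt_succ. now left.
Qed.

Definition le (x y : D) : Prop := exists z, x + z = y.
Local Infix "<=" := le : dom_scope.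

Lemma lt_succ_le x y : x < y + 1 <-> x <= y.
Proof.
  rewrite lt_iff. unfold le. split; intros [z H]; exists z.
  - now apply succ_inj.
  - now rewrite H.
Qed.

Lemma le_succ_lt x y : x + 1 <= y <-> x < y.
Proof.
  rewrite lt_iff. unfold le. split; intros [z <-]; exists z; ring.
Qed.

Lemma le_refl x : x <= x.
Proof. exists 0. ring. Qed.

Lemma le_0_l x : 0 <= x.
Proof. exists x. ring. Qed.

Lemma le_trans x y z : x <= y -> y <= z -> x <= z.
Proof. intros [u <-] [v <-]. exists (u + v). ring. Qed.

Lemma lt_le x y : x < y -> x <= y.
Proof. intros H. apply lt_succ_le, lt_succ. now left. Qed.

Lemma lt_irrefl x : ~ x < x.
Proof.
  rewrite lt_iff. intros [z H]. apply (@succ_nonzero z), (@add_cancel_l _ _ x).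
  now rewrite add_0_r, add_assoc.
Qed.

Lemma le_lt_trans x y z : x <= y -> y < z -> x < z.
Proof. rewrite <- !le_succ_lt. intros [u <-] [v <-]. exists (u + v). ring. Qed.

Lemma lt_le_trans x y z : x < y -> y <= z -> x < z.
Proof. rewrite <- !le_succ_lt. intros [u <-] [v <-]. exists (u + v). ring. Qed.

Lemma lt_trans x y z : x < y -> y < z -> x < z.
Proof. intros H K. apply (lt_le_trans H), lt_le, K. Qed.

Lemma le_or_lt x y : x <= y \/ y < x.
Proof.
  assert (H : x < y + 1 \/ y < x).
  { pattern x. apply ind0; [def| |].
    - left. apply lt_succ_le, le_0_l.
    - intros z [H|H].
      + apply lt_succ in H as [H| ->].
        * left. now apply lt_succ_le, le_succ_lt.
        * right. apply lt_succ. now right.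
      + right. apply lt_succ. now left. }
  now rewrite lt_succ_le in H.
Qed.

Lemma lt_or_eq x y : x <= y -> x < y \/ x = y.
Proof. intros H. now apply lt_succ, lt_succ_le. Qed.

Lemma lt_succ_diag x : x < x + 1.
Proof. apply lt_succ. now right. Qed.

Lemma le_add_r x y : x <= x + y.
Proof. now exists y. Qed.

Lemma le_add_l x y : x <= y + x.
Proof. exists y. ring. Qed.

Lemma add_le x x' y y' : x <= x' -> y <= y' -> x + y <= x' + y'.
Proof. intros [u <-] [v <-]. exists (u + v). ring. Qed.

Lemma mul_le x x' y y' : x <= x' -> y <= y' -> x * y <= x' * y'.
Proof. intros [u <-] [v <-]. exists (x * v + u * y + u * v). ring. Qed.

Lemma common_bound x y : exists z, x <= z /\ y <= z.
Proof. exists (x + y). split; [apply le_add_r|apply le_add_l]. Qed.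

(** * Pairing *)

Definition pair (x y : D) : D := (x + y) * (x + y) + x.

Lemma le_square x : x <= x * x.
Proof.
  destruct (zero_or_succ x) as [->|[y ->]].
  - apply le_0_l.
  - exists (y * (y + 1)). ring.
Qed.

Lemma le_pair_l x y : x <= pair x y.
Proof. apply le_add_l. Qed.

Lemma le_pair_r x y : y <= pair x y.
Proof.
  apply le_trans with ((x + y) * (x + y)); [|apply le_add_r].
  apply le_trans with (x + y); [apply le_add_l|apply le_square].
Qed.

Lemma pair_le x x' y y' : x <= x' -> y <= y' -> pair x y <= pair x' y'.
Proof. intros H K. repeat apply add_le || apply mul_le; assumption. Qed.

(** With [s = x + y], the next square exceeds [s * s] by [2 * s + 1], which is more than [x]. The
    witness given to [succ_nonzero] is the difference of the two codes less one. *)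
Lemma pair_inj_sum x y x' y' : pair x y = pair x' y' -> ~ x + y < x' + y'.
Proof.
  unfold pair. intros H L. apply lt_iff in L as [z L]. rewrite <- L in H.
  apply (@succ_nonzero (y + x + y + (x + y + x + y) * z + z * z + z + z + x')).
  apply (@add_cancel_l _ _ ((x + y) * (x + y) + x)).
  rewrite add_0_r. etransitivity; [|symmetry; exact H]. ring.
Qed.

Lemma pair_inj x y x' y' : pair x y = pair x' y' -> x = x' /\ y = y'.
Proof.
  intros H. assert (S : x + y = x' + y').
  { destruct (le_or_lt (x + y) (x' + y')) as [L|L].
    - apply lt_or_eq in L as [L|L]; [|exact L]. now apply pair_inj_sum in L.
    - symmetry in H. now apply pair_inj_sum in L. }
  unfold pair in H. rewrite S in H. apply add_cancel_l in H. subst x'.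
  apply add_cancel_l in S. auto.
Qed.

(** The pairing map is not onto, so numbers off its range get the default [(0, 0)]. The bounds make
    this graph Delta_0, although [unpair] itself comes from a choice operator outside the
    language. *)
Definition unpair_spec (w : D) (p : D * D) : Prop :=
  w = pair (fst p) (snd p) \/
  ~ (exists x, x < w + 1 /\ exists y, y < w + 1 /\ w = pair x y) /\ fst p = 0 /\ snd p = 0.

Definition unpair (w : D) : D * D := epsilon (inhabits (0, 0)) (unpair_spec w).

Lemma unpair_exists w : exists p, unpair_spec w p.
Proof.
  destruct (classic (exists x, x < w + 1 /\ exists y, y < w + 1 /\ w = pair x y))
    as [(x & _ & y & _ & H)|H].
  - exists (x, y). now left.
  - exists (0, 0). now right.
Qed.

Lemma unpair_ok w : unpair_spec w (unpair w).
Proof. exact (epsilon_spec (inhabits (0, 0)) (unpair_spec w) (unpair_exists w)). Qed.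

Lemma unpair_unique w p q : unpair_spec w p -> unpair_spec w q -> p = q.
Proof.
  destruct p as [x y], q as [x' y']. unfold unpair_spec; simpl.
  assert (K : forall x y, w = pair x y ->
    exists x, x < w + 1 /\ exists y, y < w + 1 /\ w = pair x y).
  { intros u v E. exists u. split; [apply lt_succ_le; rewrite E; apply le_pair_l|].
    exists v. split; [apply lt_succ_le; rewrite E; apply le_pair_r|exact E]. }
  intros [E|(N & -> & ->)] [E'|(N' & -> & ->)].
  - rewrite E in E'. apply pair_inj in E' as [-> ->]. reflexivity.
  - destruct N'. eauto.
  - destruct N. eauto.
  - reflexivity.
Qed.

Lemma unpair_pair x y : unpair (pair x y) = (x, y).
Proof. apply (unpair_unique (unpair_ok _)). now left. Qed.

Lemma unpair_le w : fst (unpair w) < w + 1 /\ snd (unpair w) < w + 1.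
Proof.
  rewrite !lt_succ_le. generalize (unpair_ok w). generalize (unpair w).
  intros [x y] [E|(_ & E1 & E2)]; simpl in *.
  - rewrite E. split; [apply le_pair_l|apply le_pair_r].
  - rewrite E1, E2. split; apply le_0_l.
Qed.

(** * Merging like quantifiers, and closure properties of the hierarchy *)

Definition spread (a b : D) (e : env) : env := scons a (scons b (fun i => e (S i))).

Definition unpair_env (e : env) : env :=
  spread (fst (unpair (e 0%nat))) (snd (unpair (e 0%nat))) e.

Lemma under_spread j : exists ts : nat -> env -> D, (forall i, Tm (ts i)) /\
  forall a b e, under j (spread a b) e = fun i => ts i (scons b (scons a e)).
Proof.
  induction j as [|j (ts & H & E)].
  - exists (scons (fun e => e 1%nat) (scons (fun e => e 0%nat) (fun i e => e (S (S (S i)))))).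
    split.
    + intros [|[|i]]; [exact (tm_var 1)|exact (tm_var 0)|exact (tm_var (S (S (S i))))].
    + intros a b e. apply functional_extensionality. now intros [|[|i]].
  - exists (scons (fun e => e 2%nat)
      (fun i e => ts i (scons (e 0%nat) (scons (e 1%nat) (fun j => e (S (S (S j)))))))).
    split.
    + intros [|i]; [exact (tm_var 2)|].
      pose (us := scons (fun e : env => e 0%nat) (scons (fun e => e 1%nat)
        (fun j e => e (S (S (S j)))))).
      assert (Hu : forall i, Tm (us i)).
      { intros [|[|k]]; [exact (tm_var 0)|exact (tm_var 1)|exact (tm_var (S (S (S k))))]. }
      pose proof (Tm_subst (H i) Hu) as K.
      refine (eq_ind _ (@Tm M) K _ _).
      apply functional_extensionality. intros e. simpl. f_equal.
      apply functional_extensionality. now intros [|[|k]].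
    + intros a b e. apply functional_extensionality. intros [|i]; [reflexivity|].
      simpl. now rewrite E.
Qed.

Lemma under_unpair j e :
  under j unpair_env e = under j (spread (fst (unpair (e j))) (snd (unpair (e j)))) e.
Proof.
  revert e. induction j as [|j IH]; intros e; [reflexivity|].
  simpl. now rewrite IH.
Qed.

(** The components of [e j] are at most [e j], so they can be found by a bounded search through the
    Delta_0 graph; for fixed components the transformation is a term substitution. *)
Lemma unpair_admissible O : admissible O unpair_env.
Proof.
  intros P HP j. destruct (under_spread j) as (ts & Hts & E).
  pose proof (D0_subst HP Hts) as K.
  set (Q := fun e => P (fun i => ts i e)) in K.
  assert (K' : D0 O (fun e => exists a, a < e j + 1 /\ exists b, b < e j + 1 /\
    ((e j = pair a b \/
     ~ (exists x, x < e j + 1 /\ exists y, y < e j + 1 /\ e j = pair x y) /\ a = 0 /\ b = 0)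
     /\ Q (scons b (scons a e))))).
  { apply d_bex'; [tm|]. apply d_bex'; [tm|]. apply d_and.
    - unfold pair. def.
    - refine (eq_ind_r _ K (pred_ext _)). intros e.
      replace (scons (e 0%nat) (scons (e 1%nat) (fun i => e (S (S i))))) with e; [reflexivity|].
      apply functional_extensionality. now intros [|[|i]]. }
  refine (eq_ind_r _ K' (pred_ext _)). intros e.
  rewrite under_unpair, E. split.
  - intros H. destruct (unpair_le (e j)) as [L1 L2].
    exists (fst (unpair (e j))). split; [exact L1|].
    exists (snd (unpair (e j))). split; [exact L2|]. split; [|exact H].
    apply unpair_ok.
  - intros (a & _ & b & _ & S & H).
    now rewrite (unpair_unique (p := unpair (e j)) (q := (a, b)) (unpair_ok _) S).
Qed.

Lemma hier_ex2 O n (Q : D -> D -> env -> Prop) :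
  hier O false n (fun e => Q (e 0%nat) (e 1%nat) (fun i => e (S (S i)))) ->
  hier O true (S n) (fun e => exists x, exists y, Q x y e).
Proof.
  intros H. pose proof (hier_ex (Q := fun w e => Q (fst (unpair w)) (snd (unpair w)) e)
    (hier_pull H (unpair_admissible (O := O)))) as K.
  refine (hier_ext K _). intros e. split.
  - intros [w G]. eauto.
  - intros (x & y & G). exists (pair x y). now rewrite unpair_pair.
Qed.

Lemma hier_ex' O n (Q : D -> env -> Prop) :
  hier O true (S n) (fun e => Q (e 0%nat) (fun i => e (S i))) ->
  hier O true (S n) (fun e => exists x, Q x e).
Proof.
  intros (R & HR & E).
  assert (K : forall x e, Q x e <-> exists y, R (scons y (scons x e))).
  { intros x e. change (Q x e) with ((fun e => Q (e 0%nat) (fun i => e (S i))) (scons x e)).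
    rewrite E. reflexivity. }
  assert (H : hier O false n (fun e =>
    R (fun i => (scons (fun e => e 1%nat) (scons (fun e => e 0%nat) (fun i e => e (S (S i)))))
      i e))).
  { apply (hier_subst HR). intros [|[|i]];
      [exact (tm_var 1)|exact (tm_var 0)|exact (tm_var (S (S i)))]. }
  refine (hier_ext (hier_ex2 (Q := fun x y e => R (scons y (scons x e))) (hier_ext H _)) _).
  - intros e. cbv beta.
    match goal with |- R ?a <-> R ?b => replace b with a; [reflexivity|] end.
    apply functional_extensionality. now intros [|[|i]].
  - intros e. split; intros [x G]; exists x; apply K, G.
Qed.

Lemma hier_all' O n (Q : D -> env -> Prop) :
  hier O false (S n) (fun e => Q (e 0%nat) (fun i => e (S i))) ->
  hier O false (S n) (fun e => forall x, Q x e).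
Proof.
  intros H. apply (hier_not (b := true)) in H.
  apply (hier_ex' (Q := fun x e => ~ Q x e)) in H.
  refine (hier_ext (hier_not (b := false) H) _). intros e. split.
  - intros G x. apply NNPP. intros N. apply G. now exists x.
  - intros G [x N]. exact (N (G x)).
Qed.

(** For Sigma, a conjunction needs two witnesses, merged by pairing, while a disjunction can share
    one quantifier. Pi follows by negation. *)
Lemma hier_and_or O n : forall b (P Q : env -> Prop), hier O b n P -> hier O b n Q ->
  hier O b n (fun e => P e /\ Q e) /\ hier O b n (fun e => P e \/ Q e).
Proof.
  induction n as [|n IH]; intros b P Q HP HQ.
  - split; [now apply d_and|now apply d_or].
  - assert (T : forall P Q, hier O true (S n) P -> hier O true (S n) Q ->
      hier O true (S n) (fun e => P e /\ Q e) /\ hier O true (S n) (fun e => P e \/ Q e)).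
    { clear P Q HP HQ. intros P Q (P' & HP & ->) (Q' & HQ & ->). split.
      - assert (H : hier O false n (fun e =>
          P' (scons (e 1%nat) (fun i => e (S (S i)))) /\
          Q' (scons (e 0%nat) (fun i => e (S (S i)))))).
        { apply (IH false (fun e => P' (scons (e 1%nat) (fun i => e (S (S i)))))
            (fun e => Q' (scons (e 0%nat) (fun i => e (S (S i)))))).
          - refine (hier_ext (hier_subst (ts := scons (fun e => e 1%nat)
              (fun i e => e (S (S i)))) HP _) _).
            + intros [|i]; [exact (tm_var 1)|exact (tm_var (S (S i)))].
            + intros e. match goal with |- P' ?a <-> P' ?b => replace b with a; [reflexivity|] end.
              apply functional_extensionality. now intros [|i].
          - refine (hier_ext (hier_subst (ts := scons (fun e => e 0%nat)
              (fun i e => e (S (S i)))) HQ _) _).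
            + intros [|i]; [exact (tm_var 0)|exact (tm_var (S (S i)))].
            + intros e. match goal with |- Q' ?a <-> Q' ?b => replace b with a; [reflexivity|] end.
              apply functional_extensionality. now intros [|i]. }
        refine (hier_ext (hier_ex2 (Q := fun x y e => P' (scons y e) /\ Q' (scons x e)) H) _).
        intros e. split.
        + intros (x & y & G1 & G2). eauto.
        + intros ([y G1] & [x G2]). eauto.
      - destruct (IH _ _ _ HP HQ) as [_ H].
        exists (fun e => P' e \/ Q' e). split; [exact H|].
        apply pred_ext. intros e. split.
        + intros [[x G]|[x G]]; eauto.
        + intros [x [G|G]]; eauto. }
    destruct b; [auto|].
    apply (hier_not (b := true)) in HP, HQ.
    destruct (T _ _ HP HQ) as [T1 T2]. split.
    + refine (hier_ext (hier_not (b := false) T2) _). intros e. tauto.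
    + refine (hier_ext (hier_not (b := false) T1) _). intros e. tauto.
Qed.

Lemma hier_and O n b (P Q : env -> Prop) : hier O b n P -> hier O b n Q -> hier O b n (fun e => P e /\ Q e).
Proof. intros. now apply hier_and_or. Qed.

Lemma hier_or O n b (P Q : env -> Prop) : hier O b n P -> hier O b n Q -> hier O b n (fun e => P e \/ Q e).
Proof. intros. now apply hier_and_or. Qed.

Lemma hier_imp O n b (P Q : env -> Prop) : hier O (negb b) n P -> hier O b n Q ->
  hier O b n (fun e => P e -> Q e).
Proof.
  intros HP HQ. refine (hier_ext (hier_or (hier_not HP) HQ) _). intros e. tauto.
Qed.

(** The one hard case is a bounded universal quantifier before a Sigma formula: collection gives a
    common bound [c] on the witnesses, and then [c] is the only unbounded quantifier in front of a
    Pi_n matrix. *)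
Lemma hier_bounded O n : (forall j, (j < n)%nat -> Coll O j) ->
  forall b (Q : D -> env -> Prop) f, Tm f ->
  hier O b n (fun e => Q (e 0%nat) (fun i => e (S i))) ->
  hier O b n (fun e => forall x, x < f e -> Q x e) /\
  hier O b n (fun e => exists x, x < f e /\ Q x e).
Proof.
  induction n as [|n IH]; intros C b Q f Hf H.
  - split; [now apply d_ball'|now apply d_bex'].
  - assert (C' : forall j, (j < n)%nat -> Coll O j) by (intros; apply C; lia).
    assert (T : forall (Q : D -> env -> Prop) f, Tm f ->
      hier O true (S n) (fun e => Q (e 0%nat) (fun i => e (S i))) ->
      hier O true (S n) (fun e => forall x, x < f e -> Q x e) /\
      hier O true (S n) (fun e => exists x, x < f e /\ Q x e)).
    { clear b Q f Hf H. intros Q f Hf H. split.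
      - destruct H as (R & HR & E).
        assert (K : forall x e, Q x e <-> exists y, R (scons y (scons x e))).
        { intros x e.
          change (Q x e) with ((fun e => Q (e 0%nat) (fun i => e (S i))) (scons x e)).
          rewrite E. reflexivity. }
        assert (H1 : hier O false n (fun e => exists y, y < e 1%nat /\
          R (scons y (scons (e 0%nat) (fun i => e (S (S i))))))).
        { destruct (IH C' false (fun y e => R (scons y (scons (e 0%nat) (fun i => e (S (S i))))))
            (fun e => e 1%nat) (tm_var 1)) as [_ H1]; [|exact H1].
          refine (hier_ext (hier_subst (ts := scons (fun e => e 0%nat) (scons (fun e => e 1%nat)
            (fun i e => e (S (S (S i)))))) HR _) _).
          - intros [|[|i]]; [exact (tm_var 0)|exact (tm_var 1)|exact (tm_var (S (S (S i))))].
          - intros e. match goal with |- R ?a <-> R ?b => replace b with a; [reflexivity|] end.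
            apply functional_extensionality. now intros [|[|i]]. }
        destruct (IH C' false (fun x e => exists y, y < e 0%nat /\
          R (scons y (scons x (fun i => e (S i))))) (fun e => f (fun i => e (S i)))
          (Tm_subst Hf (fun i => tm_var (S i))) H1) as [H2 _].
        refine (hier_ext (hier_ex (Q := fun c e => forall x, x < f e -> exists y, y < c /\
          R (scons y (scons x e))) H2) _).
        intros e. split.
        + intros [c G] x L. apply K. destruct (G x L) as (y & _ & G'). eauto.
        + intros G. apply (C n (Nat.lt_succ_diag_r n) (fun x y => R (scons y (scons x e)))).
          * refine (hier_ext (hier_subst (ts := scons (fun e => e 1%nat) (scons (fun e => e 0%nat)
              (fun i _ => e i))) HR _) _).
            -- intros [|[|i]]; [exact (tm_var 1)|exact (tm_var 0)|exact (tm_const (e i))].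
            -- intros e'. match goal with |- R ?a <-> R ?b => replace b with a; [reflexivity|] end.
               apply functional_extensionality. now intros [|[|i]].
          * intros x L. apply K, G, L.
      - apply (hier_ex' (Q := fun x e => x < f e /\ Q x e)).
        apply (hier_and (P := fun e => e 0%nat < f (fun i => e (S i)))); [|exact H].
        apply D0_hier, d_lt; [exact (tm_var 0)|exact (Tm_subst Hf (fun i => tm_var (S i)))]. }
    destruct b; [auto|].
    apply (hier_not (b := true)) in H.
    destruct (T (fun x e => ~ Q x e) f Hf H) as [T1 T2]. split.
    + refine (hier_ext (hier_not (b := false) T2) _). intros e. split.
      * intros G x L. apply NNPP. intros N. apply G. eauto.
      * intros G (x & L & N). apply N, G, L.
    + refine (hier_ext (hier_not (b := false) T1) _). intros e. split.
      * intros G. apply NNPP. intros N. apply G. intros x L K. apply N. eauto.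
      * intros (x & L & K) G. exact (G x L K).
Qed.

Lemma hier_ball O n b (Q : D -> env -> Prop) f : (forall j, (j < n)%nat -> Coll O j) -> Tm f ->
  hier O b n (fun e => Q (e 0%nat) (fun i => e (S i))) ->
  hier O b n (fun e => forall x, x < f e -> Q x e).
Proof. intros C Hf H. exact (proj1 (hier_bounded C Hf H)). Qed.

Lemma hier_bex O n b (Q : D -> env -> Prop) f : (forall j, (j < n)%nat -> Coll O j) -> Tm f ->
  hier O b n (fun e => Q (e 0%nat) (fun i => e (S i))) ->
  hier O b n (fun e => exists x, x < f e /\ Q x e).
Proof. intros C Hf H. exact (proj2 (hier_bounded C Hf H)). Qed.

(** Induction on [c] yields a bound good for all [x < c]. That this predicate is Sigma_(n+1) uses
    collection at lower levels, hence the strong induction on [n]. *)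
Lemma Ind_Coll (O : oracles M) n : Ind O (S n) -> Coll O n.
Proof.
  induction n as [n IH] using lt_wf_ind. intros HI R HR a Ha.
  assert (C : forall j, (j < n)%nat -> Coll O j).
  { intros j L. apply IH; [exact L|]. apply (Ind_le (m := S n)); [lia|exact HI]. }
  assert (H : forall c, exists b, forall x, x < c -> x < a -> exists y, y < b /\ R x y).
  { apply HI.
    - apply (hier_ex (Q := fun b e => forall x, x < e 0%nat -> x < a -> exists y, y < b /\ R x y)).
      apply hier_ball; [exact C|tm|]. apply hier_imp; [apply D0_hier; def|].
      apply hier_bex; [exact C|tm|]. apply (hier_2 HR); tm.
    - exists 0. intros x L. now apply nlt_0_r in L.
    - intros c [b Hb]. destruct (classic (c < a)) as [L|L].
      + destruct (Ha c L) as [y Hy]. exists (b + (y + 1)). intros x Lx La.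
        apply lt_succ in Lx as [Lx| ->].
        * destruct (Hb x Lx La) as (z & Lz & Hz). exists z. split; [|exact Hz].
          exact (lt_le_trans Lz (le_add_r _ _)).
        * exists y. split; [|exact Hy].
          exact (lt_le_trans (lt_succ_diag y) (le_add_l _ _)).
      + exists b. intros x Lx La. apply lt_succ in Lx as [Lx| ->]; auto. now destruct L. }
  destruct (H a) as [b Hb]. exists b. auto.
Qed.

Lemma Ind_Coll_below (O : oracles M) n : Ind O n -> forall j, (j < n)%nat -> Coll O j.
Proof. intros H j L. apply Ind_Coll. exact (Ind_le L H). Qed.

(** * Exchanging Delta_2 oracles for a level of induction *)

Definition Delta2 (O O' : oracles M) : Prop := forall A, O' A ->
  forall b, hier O b 2 (fun e => A (e 0%nat) (e 1%nat) (e 2%nat)).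

Lemma Delta2_D0 O O' : Ind O 2 -> Delta2 O O' -> forall P, D0 O' P -> forall b, hier O b 2 P.
Proof.
  intros HI HO. pose proof (Ind_Coll_below HI) as C.
  induction 1 as [f g|f g|A f g h HA| |P Q|P Q|P Q|f P|f P]; intros b.
  - apply D0_hier. now apply d_eq.
  - apply D0_hier. now apply d_lt.
  - apply hier_3; auto.
  - apply D0_hier. apply d_bot.
  - apply hier_imp; auto.
  - apply hier_and; auto.
  - apply hier_or; auto.
  - apply hier_ball; auto. refine (hier_ext (IHD0 b) _). intros e. now rewrite scons_eta.
  - apply hier_bex; auto. refine (hier_ext (IHD0 b) _). intros e. now rewrite scons_eta.
Qed.

(** A Delta_0 matrix over [O'] is Delta_2 over [O]. Of its two forms the one beginning with the same
    quantifier as the innermost of the prefix is taken, so that the two merge and only one level is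
    lost. *)
Lemma Delta2_hier O O' n : Ind O 2 -> Delta2 O O' -> forall b P,
  hier O' b (S n) P -> hier O b (S (S n)) P.
Proof.
  intros HI HO. induction n as [|n IH]; intros b P (Q & HQ & ->).
  - destruct b.
    + apply (hier_ex' (Q := fun x e => Q (scons x e))).
      refine (hier_ext (Delta2_D0 HI HO HQ true) _). intros e. now rewrite scons_eta.
    + apply (hier_all' (Q := fun x e => Q (scons x e))).
      refine (hier_ext (Delta2_D0 HI HO HQ false) _). intros e. now rewrite scons_eta.
  - exists Q. split; [exact (IH _ _ HQ)|reflexivity].
Qed.

Lemma Delta2_Ind O O' n : Ind O (S (S n)) -> Delta2 O O' -> Ind O' (S n).
Proof.
  intros HI HO P HP. apply HI. refine (Delta2_hier _ HO HP).
  apply (Ind_le (m := S (S n))); [lia|exact HI].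
Qed.

(** * Finite sets coded by divisibility *)

(** These are the moduli of Goedel's beta function. Only divisibility is used: a finite set is coded
    by a product of the moduli of its elements. *)
Definition modulus (q i : D) : D := (i + 1) * q + 1.

Definition divides (q i p : D) : Prop := exists t, t < p + 1 /\ p = modulus q i * t.

Lemma divides_iff q i p : divides q i p <-> exists t, p = modulus q i * t.
Proof.
  split.
  - intros (t & _ & H). eauto.
  - intros [t H]. exists t. split; [|exact H]. apply lt_succ_le. rewrite H.
    exists ((i + 1) * q * t). unfold modulus. ring.
Qed.

(** With [q] divisible by [1, ..., a], the moduli of the indices below [a] are
    pairwise coprime. *)
Definition good_base (a q : D) : Prop :=
  q <> 0 /\ forall d, d < a -> exists t, t < q + 1 /\ q = (d + 1) * t.

Lemma mul_eq_0 x y : x * y = 0 -> x = 0 \/ y = 0.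
Proof.
  intros H. destruct (zero_or_succ x) as [->|[u ->]]; [now left|].
  right. rewrite mul_add_l, mul_1_l in H. now apply add_eq_0 in H.
Qed.

Lemma good_base_exists a : exists q, good_base a q.
Proof.
  pattern a. apply arith_ind.
  - apply (hier_ex (Q := fun q e => good_base (e 0%nat) q)). unfold good_base, not. def.
  - exists 1. split.
    + intros H. apply (@succ_nonzero 0). now rewrite add_0_l.
    + intros d L. now apply nlt_0_r in L.
  - intros b (q & Hq & H). exists (q * (b + 1)). split.
    + intros E. apply mul_eq_0 in E as [E|E]; [easy|]. now apply succ_nonzero in E.
    + intros d L. apply lt_succ in L as [L| ->].
      * destruct (H d L) as (t & _ & E). exists (t * (b + 1)). split.
        -- apply lt_succ_le. rewrite E at 1. exists (d * t * (b + 1)). ring.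
        -- rewrite E at 1. ring.
      * exists q. split; [|ring]. apply lt_succ_le. exists (q * b). ring.
Qed.

Lemma divide_sub x u v b : x * u = x * v + b -> exists w, b = x * w.
Proof.
  intros H. destruct (le_or_lt u v) as [[c <-]|L].
  - exists 0.
    assert (E : x * c + b = 0).
    { apply (@add_cancel_l _ _ (x * u)). rewrite add_0_r.
      etransitivity; [|symmetry; exact H]. ring. }
    apply add_eq_0 in E as [_ ->]. ring.
  - apply lt_iff in L as [c <-]. exists (c + 1). apply (@add_cancel_l _ _ (x * v)).
    rewrite <- H. ring.
Qed.

Lemma modulus_coprime a q i j p : good_base a q -> i < a -> j < a -> i <> j ->
  divides q i (p * modulus q j) -> divides q i p.
Proof.
  rewrite !divides_iff. intros [_ G] Li Lj N [u H].
  (* Eliminating [q] from the two moduli: [(i + 1)] times the second and [(j + 1)] times the first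
     differ by the distance of [i] and [j], which is [s + 1]. *)
  assert (K : exists s, s < a /\ exists w, (s + 1) * p = modulus q i * w).
  { destruct (le_or_lt i j) as [L|L].
    - apply lt_or_eq in L as [L|L]; [|easy]. apply lt_iff in L as [s E].
      exists s. split.
      + apply (@le_lt_trans _ j); [|exact Lj]. exists (i + 1). rewrite <- E. ring.
      + apply divide_sub with (u := (j + 1) * p) (v := (i + 1) * u).
        transitivity ((i + 1) * (modulus q i * u) + (s + 1) * p); [|ring].
        rewrite <- H, <- E. unfold modulus. ring.
    - apply lt_iff in L as [s E]. exists s. split.
      + apply (@le_lt_trans _ i); [|exact Li]. exists (j + 1). rewrite <- E. ring.
      + apply divide_sub with (u := (i + 1) * u) (v := (j + 1) * p).
        transitivity ((i + 1) * (modulus q i * u)); [ring|].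
        rewrite <- H, <- E. unfold modulus. ring. }
  destruct K as (s & Ls & w & K). destruct (G s Ls) as (t & _ & Et).
  (* Since [s + 1] divides [q], the modulus of [i] divides [q * p], and [p] is [modulus q i * p]
     minus [(i + 1) * q * p]. *)
  apply divide_sub with (u := p) (v := (i + 1) * (w * t)).
  transitivity ((i + 1) * (modulus q i * w * t) + p); [|ring].
  rewrite <- K. transitivity ((i + 1) * (p * ((s + 1) * t)) + p); [|ring].
  rewrite <- Et. unfold modulus. ring.
Qed.

Lemma modulus_not_1 q i : q <> 0 -> ~ divides q i 1.
Proof.
  rewrite divides_iff. intros Hq [t H].
  destruct (zero_or_succ t) as [->|[v ->]].
  - rewrite mul_0_r in H. apply (@succ_nonzero 0). now rewrite add_0_l.
  - apply Hq. assert (E : q + (i * q + v * modulus q i) = 0).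
    { apply (@add_cancel_r _ _ 1). rewrite add_0_l.
      etransitivity; [|symmetry; exact H]. unfold modulus. ring. }
    now apply add_eq_0 in E as [E _].
Qed.

(** The new modulus is multiplied in exactly when [c] is an element below [a]; coprimality protects
    the other memberships. The two possible values of [p'] are recorded for the size estimate in
    [code_bound_exists]. *)
Lemma code_step a q c p (A : D -> Prop) : good_base a q ->
  (forall i, i < a -> (divides q i p <-> i < c /\ A i)) ->
  exists p', (p' = p \/ p' = p * modulus q c) /\
    forall i, i < a -> (divides q i p' <-> i < c + 1 /\ A i).
Proof.
  intros G H. destruct (classic (c < a /\ A c)) as [[L Ac]|N].
  - exists (p * modulus q c). split; [now right|]. intros i Li.
    destruct (classic (i = c)) as [->|Ne].
    + rewrite lt_succ, divides_iff. split; [tauto|]. intros _. exists p. ring.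
    + rewrite lt_succ. transitivity (divides q i p).
      * split; [now apply (modulus_coprime G)|].
        rewrite !divides_iff. intros [t E]. exists (t * modulus q c). rewrite E. ring.
      * rewrite (H i Li). tauto.
  - exists p. split; [now left|]. intros i Li. rewrite (H i Li), lt_succ.
    split; [tauto|]. intros [[L| ->] Ai]; tauto.
Qed.

Lemma D0_divides O (f g h : env -> D) : Tm f -> Tm g -> Tm h ->
  D0 O (fun e => divides (f e) (g e) (h e)).
Proof.
  apply (hier_3 (n := 0) (b := true)). unfold divides, modulus. simpl. def.
Qed.

Definition El (i w : D) : Prop :=
  exists q, q < w + 1 /\ exists p, p < w + 1 /\ w = pair q p /\ divides q i p.

Lemma El_pair i q p : El i (pair q p) <-> divides q i p.
Proof.
  split.
  - intros (q' & _ & p' & _ & E & H). apply pair_inj in E as [-> ->]. exact H.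
  - intros H. exists q. split; [apply lt_succ_le, le_pair_l|].
    exists p. split; [apply lt_succ_le, le_pair_r|auto].
Qed.

Ltac def_hook ::= first [apply D0_divides].

Lemma D0_El O (f g : env -> D) : Tm f -> Tm g -> D0 O (fun e => El (f e) (g e)).
Proof.
  apply (hier_2 (n := 0) (b := true)). unfold El, pair. simpl. def.
Qed.

Ltac def_hook ::= first [apply D0_El | apply D0_divides].

Lemma finite_comprehension O (A : D -> Prop) a : Ind O 1 -> D0 O (fun e => A (e 0%nat)) ->
  exists w, forall i, i < a -> (El i w <-> A i).
Proof.
  intros HI HA. destruct (good_base_exists a) as [q G].
  assert (H : forall c, exists p, forall i, i < a -> (divides q i p <-> i < c /\ A i)).
  { apply HI.
    - apply (hier_ex (Q := fun p e => forall i, i < a ->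
        (divides q i p <-> i < e 0%nat /\ A i))). simpl.
      apply d_ball'; [tm|]. apply d_iff; [def|]. apply d_and; [def|].
      apply (hier_1 (n := 0) (b := true) HA). tm.
    - exists 1. intros i _. split.
      + intros K. now apply modulus_not_1 in K; [|apply G].
      + intros [L _]. now apply nlt_0_r in L.
    - intros c [p H]. destruct (code_step G H) as (p' & _ & K). eauto. }
  destruct (H a) as [p K]. exists (pair q p). intros i L. rewrite El_pair, (K i L). tauto.
Qed.

Definition agree (m w w' : D) : Prop := forall i, i < m -> (El i w <-> El i w').

(** Codes are not unique, hence "has a code below [B]" instead of a bound on all codes. *)
Definition code_bound (m B : D) : Prop := forall w, exists w', w' < B /\ agree m w' w.

(** The products are bounded for all [w] at once, each step multiplying the bound by one modulus.
    The uniformity in [w] is why Sigma_2 induction is used. *)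
Lemma code_bound_exists m : Ind (no_oracles (M := M)) 2 -> exists B, code_bound m B.
Proof.
  intros HI. destruct (good_base_exists m) as [q G].
  assert (H : forall c, exists B, forall w, exists p, p < B /\
    forall i, i < m -> (divides q i p <-> i < c /\ El i w)).
  { apply HI.
    - apply (hier_ex (Q := fun B e => forall w, exists p, p < B /\
        forall i, i < m -> (divides q i p <-> i < e 0%nat /\ El i w))).
      apply (hier_all (Q := fun w e => exists p, p < e 0%nat /\
        forall i, i < m -> (divides q i p <-> i < e 1%nat /\ El i w))).
      simpl. def.
    - exists (1 + 1). intros w. exists 1. split; [apply lt_succ_diag|]. intros i _. split.
      + intros K. now apply modulus_not_1 in K; [|apply G].
      + intros [L _]. now apply nlt_0_r in L.
    - intros c [B H]. exists (B * modulus q c + 1). intros w.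
      destruct (H w) as (p & Lp & Hp). destruct (code_step G Hp) as (p' & E & K).
      exists p'. split; [|exact K]. apply lt_succ_le. apply lt_le in Lp as [d <-].
      destruct E as [-> | ->]; unfold modulus;
        [exists (p * ((c + 1) * q) + d * ((c + 1) * q + 1))|exists (d * ((c + 1) * q + 1))]; ring. }
  destruct (H m) as [B K]. exists (pair q B + 1). intros w.
  destruct (K w) as (p & Lp & Hp). exists (pair q p). split.
  - apply lt_succ_le, pair_le; [apply le_refl|now apply lt_le].
  - intros i L. rewrite El_pair, (Hp i L). tauto.
Qed.

Ltac def_hook ::= first [apply D0_El | apply D0_divides
  | match goal with
    | H : D0 _ _ |- _ => first
      [ apply (hier_3 (n := 0) (b := true) H)
      | apply (hier_2 (n := 0) (b := true) H)
      | apply (hier_1 (n := 0) (b := true) H) ]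
    end].

(** * Iterated "there are infinitely many" *)

Fixpoint infs (n : nat) (S : D -> Prop) (t : D) : Prop :=
  match n with
  | 0 => S t
  | Datatypes.S n => forall b, exists x, b < x /\ infs n S (pair t x)
  end.

Lemma infs_mono n (S S' : D -> Prop) : (forall t, S t -> S' t) ->
  forall t, infs n S t -> infs n S' t.
Proof.
  intros H. induction n as [|n IH]; intros t; [apply H|].
  intros K b. destruct (K b) as (x & L & G). eauto.
Qed.

(** The recursion of [infs] splits off the outermost quantifier, whereas the construction drops the
    last argument, that is, the innermost. *)
Lemma infs_snoc n (S : D -> Prop) : forall t,
  infs n (fun t => forall b, exists x, b < x /\ S (pair t x)) t -> infs (Datatypes.S n) S t.
Proof.
  induction n as [|n IH]; intros t H; [exact H|].
  intros b. destruct (H b) as (x & L & G). exists x. split; [exact L|]. exact (IH _ G).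
Qed.

(** The codes of tuples of length [r] in which a zero has been put in front. *)
Fixpoint valid (r : nat) (t : D) : Prop :=
  match r with
  | 0 => t = 0
  | S r => exists t' x, t = pair t' x /\ valid r t'
  end.

(** [N b w m] stands for "there is [x > b] such that the finite set [w] and the
    set of all [pair t d] for which the tuple [t] followed by [x] has colour [d]
    agree below [m]".  A state is a consistent family of such assertions. *)
Record state (k : D) (r : nat) (N : D -> D -> D -> Prop) : Prop := State {
  state_total : forall b m, exists w, N b w m;
  state_mono : forall b w m b' w' m',
    N b w m -> b' <= b -> m' <= m -> agree m' w' w -> N b' w' m';
  state_color : forall b w m t, N b w m -> valid r t ->
    (forall d, d < k -> pair t d < m) -> exists d, d < k /\ El (pair t d) w
}.

Lemma agree_refl m w : agree m w w.
Proof. intros i _. reflexivity. Qed.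

Lemma state_bounded k r N m B b : state k r N -> code_bound m B ->
  exists w, w < B /\ N b w m.
Proof.
  intros HN HB. destruct (state_total HN b m) as [w Hw]. destruct (HB w) as (w' & L & A).
  exists w'. split; [exact L|].
  exact (state_mono HN Hw (le_refl b) (le_refl m) A).
Qed.

(** Otherwise every [w < B] satisfying [Z] fails at some [b]; collection bounds these [b] by a [c],
    and a [w] that works at [c] works below it by monotonicity. *)
Lemma state_compact O k r N (Z : D -> Prop) m B : Coll O 0 ->
  D0 O (fun e => N (e 0%nat) (e 1%nat) (e 2%nat)) -> D0 O (fun e => Z (e 0%nat)) ->
  state k r N -> (forall b, exists w, w < B /\ N b w m /\ Z w) ->
  exists w, w < B /\ (forall b, N b w m) /\ Z w.
Proof.
  intros C DN DZ HN H. apply NNPP. intros K.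
  destruct (C (fun w b => N b w m -> ~ Z w)) with (a := B) as [c Hc].
  - unfold not. simpl. def.
  - intros w L. apply NNPP. intros G. apply K. exists w. split; [exact L|]. split.
    + intros b. apply NNPP. intros Nb. apply G. exists b. tauto.
    + apply NNPP. intros Nz. apply G. exists 0. tauto.
  - destruct (H c) as (w & L & Hw & Hz). destruct (Hc w L) as (b & Lb & G).
    apply G; [|exact Hz].
    exact (state_mono HN Hw (lt_le Lb) (le_refl m) (@agree_refl m w)).
Qed.

Lemma D0_true O : D0 O (fun _ : env => True).
Proof. refine (eq_ind_r _ (d_imp (d_bot O) (d_bot O)) (pred_ext _)). tauto. Qed.

Lemma hier_iff O n b (P Q : env -> Prop) : (forall b, hier O b n P) -> (forall b, hier O b n Q) ->
  hier O b n (fun e => P e <-> Q e).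
Proof. intros. apply hier_and; apply hier_imp; auto. Qed.

(** The finite approximation [(w, m)] already contains an
    [x > b] witnessing that [u] is right about the projected colouring below [l]. *)
Definition shows (b u l w m : D) : Prop :=
  exists x, x < m /\ (b < x /\ forall i, i < l -> forall t, t < i + 1 -> forall d, d < i + 1 ->
    i = pair t d ->
    pair (pair t x) d < m /\ (El i u <-> El (pair (pair t x) d) w)).

Definition fact (b u l : D) : D := pair (pair b u) l.

Lemma fact_inj b u l b' u' l' : fact b u l = fact b' u' l' -> b = b' /\ u = u' /\ l = l'.
Proof. intros H. apply pair_inj in H as [H ->]. apply pair_inj in H as [-> ->]. auto. Qed.

Definition shows_fact (j w m : D) : Prop :=
  exists b, b < j + 1 /\ exists u, u < j + 1 /\ exists l, l < j + 1 /\
    (j = fact b u l /\ shows b u l w m).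

Lemma shows_fact_iff b u l w m : shows_fact (fact b u l) w m <-> shows b u l w m.
Proof.
  split.
  - intros (b' & _ & u' & _ & l' & _ & E & H). apply fact_inj in E as (-> & -> & ->). exact H.
  - intros H. exists b. split; [|exists u; split; [|exists l; split; [|auto]]];
      apply lt_succ_le; unfold fact.
    + apply le_trans with (pair b u); apply le_pair_l.
    + apply le_trans with (pair b u); [apply le_pair_r|apply le_pair_l].
    + apply le_pair_r.
Qed.

Lemma D0_shows_fact O (f g h : env -> D) : Tm f -> Tm g -> Tm h ->
  D0 O (fun e => shows_fact (f e) (g e) (h e)).
Proof.
  apply (hier_3 (n := 0) (b := true)). unfold shows_fact, shows, fact, pair. simpl. def.
Qed.

(** * One low basis step: dropping the last argument *)

Section Jump.
Variables (O : oracles M) (N : D -> D -> D -> Prop) (k : D) (r : nat).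
Hypothesis HI : Ind O 2.
Hypothesis DN : D0 O (fun e => N (e 0%nat) (e 1%nat) (e 2%nat)).
Hypothesis DB : D0 O (fun e => code_bound (e 0%nat) (e 1%nat)).
Hypothesis HB : forall m, exists B, code_bound m B.
Hypothesis HN : state k (S r) N.

Definition refutes (F s w m : D) : Prop := forall j, j < s -> El j F -> ~ shows_fact j w m.

(** This says that the tree of approximations refuting [F] is infinite. The premise on [B] bounds
    the search for [w], which makes the condition Pi_1 with [code_bound] as an oracle. *)
Definition can_refute (F s : D) : Prop :=
  forall m b B, code_bound m B -> exists w, w < B /\ (N b w m /\ refutes F s w m).

Definition can_refute_also (F s : D) : Prop :=
  forall m b B, code_bound m B ->
  exists w, w < B /\ (N b w m /\ (refutes F s w m /\ ~ shows_fact s w m)).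

(** [F] is below [s] the greedily chosen set of facts that are refuted. *)
Definition greedy (F s : D) : Prop := forall j, j < s -> (El j F <-> can_refute_also F j).

Definition refuted (j : D) : Prop := exists F, greedy F (j + 1) /\ El j F.

Definition jump (b u l : D) : Prop := ~ refuted (fact b u l).

Lemma jump_Coll j : (j < 2)%nat -> Coll O j.
Proof. apply (Ind_Coll_below HI). Qed.

Lemma can_refute_Pi1 : hier O false 1 (fun e => can_refute (e 0%nat) (e 1%nat)).
Proof.
  unfold can_refute, refutes, not. do 3 apply hier_all'. apply D0_hier.
  apply d_imp; [def|]. apply d_bex'; [tm|]. apply d_and; [def|].
  apply d_ball'; [tm|]. apply d_imp; [def|]. apply d_imp; [|apply d_bot].
  apply D0_shows_fact; tm.
Qed.

Lemma can_refute_also_Pi1 : hier O false 1 (fun e => can_refute_also (e 0%nat) (e 1%nat)).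
Proof.
  unfold can_refute_also, refutes, not. do 3 apply hier_all'. apply D0_hier.
  apply d_imp; [def|]. apply d_bex'; [tm|]. apply d_and; [def|].
  apply d_and; [apply d_ball'; [tm|]; apply d_imp; [def|]|];
    (apply d_imp; [|apply d_bot]; apply D0_shows_fact; tm).
Qed.

Lemma greedy_Delta2 b : hier O b 2 (fun e => greedy (e 0%nat) (e 1%nat)).
Proof.
  unfold greedy. apply hier_ball; [exact jump_Coll|tm|]. apply hier_iff; intros b'.
  - apply D0_hier. def.
  - apply (hier_2 (P := can_refute_also)); [|tm|tm].
    destruct b'; [apply (hier_dual (b := false))|apply hier_S]; exact can_refute_also_Pi1.
Qed.

Lemma can_refute_also_ext F F' s : (forall j, j < s -> (El j F <-> El j F')) ->
  can_refute_also F s -> can_refute_also F' s.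
Proof.
  intros E H m b B Hb. destruct (H m b B Hb) as (w & L & Hw & R & Ns).
  exists w. split; [exact L|]. split; [exact Hw|]. split; [|exact Ns].
  intros j Lj Ej. apply R; [exact Lj|]. now apply E.
Qed.

Lemma greedy_le F s s' : s' <= s -> greedy F s -> greedy F s'.
Proof. intros L H j Lj. apply H. exact (lt_le_trans Lj L). Qed.

Lemma greedy_exists s : exists F, greedy F s.
Proof.
  pattern s. apply HI.
  - apply (hier_ex' (Q := fun F e => greedy F (e 0%nat))).
    apply (hier_2 (greedy_Delta2 true)); tm.
  - exists 0. intros j L. now apply nlt_0_r in L.
  - clear s. intros s [F HF].
    (* Membership of [s] is settled by a case distinction, so only a Delta_0 set of codes has to be
       formed; the other bits are copied from [F]. *)
    assert (K : exists F', (forall j, j < s -> (El j F' <-> El j F)) /\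
      (El s F' <-> can_refute_also F s)).
    { assert (I1 : Ind (no_oracles (M := M)) 1) by exact arith_ind.
      destruct (classic (can_refute_also F s)) as [C|C].
      - destruct (finite_comprehension (A := fun j => j = s \/ El j F) (s + 1) I1)
          as [F' HF']; [def|]. exists F'. split.
        + intros j L. rewrite HF' by (apply lt_succ; now left). split; [|tauto].
          intros [->|G]; [now apply lt_irrefl in L|exact G].
        + rewrite HF' by apply lt_succ_diag. tauto.
      - destruct (finite_comprehension (A := fun j => j < s /\ El j F) (s + 1) I1)
          as [F' HF']; [def|]. exists F'. split.
        + intros j L. rewrite HF' by (apply lt_succ; now left). tauto.
        + rewrite HF' by apply lt_succ_diag. split; [|tauto].
          intros [L _]. now apply lt_irrefl in L. }
    destruct K as (F' & K1 & K2). exists F'. intros j L. apply lt_succ in L as [L| ->].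
    + rewrite (K1 j L), (HF j L).
      split; apply can_refute_also_ext; intros i Li;
        [symmetry|]; apply K1; exact (lt_trans Li L).
    + rewrite K2. split; apply can_refute_also_ext; intros i Li; [symmetry|]; now apply K1.
Qed.

Lemma greedy_unique F F' s : greedy F s -> greedy F' s ->
  forall j, j < s -> (El j F <-> El j F').
Proof.
  intros H H'. assert (K : forall c j, j < c -> j < s -> (El j F <-> El j F')).
  { intros c. pattern c. apply ind0; clear c; [def| |].
    - intros j L. now apply nlt_0_r in L.
    - intros c IH j L Ls. apply lt_succ in L as [L| ->]; [auto|].
      rewrite (H c Ls), (H' c Ls).
      split; apply can_refute_also_ext; intros i Li; [|symmetry];
        apply IH; trivial; exact (lt_trans Li Ls). }
  intros j L. exact (K (j + 1) j (lt_succ_diag j) L).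
Qed.

Lemma refuted_iff F s j : greedy F s -> j < s -> (refuted j <-> El j F).
Proof.
  intros H L. assert (H' : greedy F (j + 1)).
  { apply greedy_le with s; [now apply le_succ_lt|exact H]. }
  split.
  - intros (F' & G & K). apply (greedy_unique H' G (lt_succ_diag j)). exact K.
  - intros K. exists F. auto.
Qed.

(** Greedy sets exist and are unique below their length, so some greedy set contains [j] exactly
    when none omits it. *)
Lemma refuted_Delta2 b : hier O b 2 (fun e => refuted (e 0%nat)).
Proof.
  assert (T : hier O true 2 (fun e => refuted (e 0%nat))).
  { apply (hier_ex' (Q := fun F e => greedy F (e 0%nat + 1) /\ El (e 0%nat) F)).
    apply hier_and; [|apply D0_hier; def]. apply (hier_2 (greedy_Delta2 true)); tm. }
  destruct b; [exact T|].
  assert (T' : hier O true 2 (fun e => exists F, greedy F (e 0%nat + 1) /\ ~ El (e 0%nat) F)).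
  { apply (hier_ex' (Q := fun F e => greedy F (e 0%nat + 1) /\ ~ El (e 0%nat) F)).
    apply hier_and; [|apply D0_hier; unfold not; def]. apply (hier_2 (greedy_Delta2 true)); tm. }
  refine (hier_ext (hier_not (b := false) T') _). intros e.
  destruct (greedy_exists (e 0%nat + 1)) as [F HF].
  rewrite (refuted_iff HF (lt_succ_diag _)). split.
  - intros K. apply NNPP. intros G. apply K. eauto.
  - intros K (F' & HF' & G). apply G. apply (greedy_unique HF HF' (lt_succ_diag _)). exact K.
Qed.

Lemma jump_Delta2 b : hier O b 2 (fun e => jump (e 0%nat) (e 1%nat) (e 2%nat)).
Proof.
  unfold jump. apply hier_not. apply (hier_1 (refuted_Delta2 (negb b))).
  unfold fact, pair. tm.
Qed.

Lemma greedy_can_refute F s : greedy F s -> can_refute F s.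
Proof.
  intros H. assert (K : forall c, c < s + 1 -> can_refute F c).
  { intros c. pattern c. apply HI; clear c.
    - apply hier_imp; [apply D0_hier; def|]. apply (hier_dual (b := false)).
      apply (hier_2 can_refute_Pi1); tm.
    - intros _ m b B Hb. destruct (state_bounded b HN Hb) as (w & L & Hw).
      exists w. repeat split; auto. intros j Lj. now apply nlt_0_r in Lj.
    - intros c IH L m b B Hb. apply lt_succ_le, le_succ_lt in L.
      destruct (classic (El c F)) as [C|C].
      + apply (H c L) in C. destruct (C m b B Hb) as (w & Lw & Hw & R & Ns).
        exists w. split; [exact Lw|]. split; [exact Hw|]. intros j Lj Ej.
        apply lt_succ in Lj as [Lj| ->]; auto.
      + destruct (IH (lt_trans L (lt_succ_diag s)) m b B Hb) as (w & Lw & Hw & R).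
        exists w. split; [exact Lw|]. split; [exact Hw|]. intros j Lj Ej.
        apply lt_succ in Lj as [Lj| ->]; auto. }
  exact (K s (lt_succ_diag s)).
Qed.

(** By maximality of the greedy set, a fact outside of it is shown by an
    approximation that survives for all [b] and refutes the whole set. *)
Lemma jump_shown F s b u l : greedy F s -> fact b u l < s -> jump b u l ->
  exists w m, (forall b, N b w m) /\ refutes F s w m /\ shows b u l w m.
Proof.
  intros HF L HJ. unfold jump in HJ. rewrite (refuted_iff HF L), (HF _ L) in HJ.
  apply not_all_ex_not in HJ as [m HJ]. apply not_all_ex_not in HJ as [b0 HJ].
  apply not_all_ex_not in HJ as [B HJ]. apply imply_to_and in HJ as [Hb HJ].
  assert (DZ : D0 O (fun e => refutes F s (e 0%nat) m)).
  { unfold refutes, not. apply d_ball'; [tm|]. apply d_imp; [def|].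
    apply d_imp; [|apply d_bot]. apply D0_shows_fact; tm. }
  (* [m], [b0] and [B] witness that the fact cannot be refuted as well. The [w] obtained by
     compactness serves every [b], hence [b0]; if it failed to show the fact, it would contradict
     that choice. *)
  destruct (state_compact (jump_Coll Nat.lt_0_2) DN DZ HN
    (fun b => greedy_can_refute HF b Hb)) as (w & Lw & Hw & R).
  exists w, m. split; [exact Hw|]. split; [exact R|].
  apply shows_fact_iff, NNPP. intros Ns. apply HJ. exists w.
  repeat split; auto. intros j Lj. apply R. exact (lt_trans Lj L).
Qed.

(** Each clause compares facts on a common approximation that respects the greedy set: refuted facts
    are not shown there, true ones are shown by some [x]. *)
Lemma jump_state : state k r jump.
Proof.
  constructor.
  - intros b l. apply NNPP. intros K.
    assert (R : forall u, refuted (fact b u l)).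
    { intros u. apply NNPP. intros G. apply K. now exists u. }
    destruct (HB l) as [B Hl].
    (* Long enough to decide [fact b u l] for all [u < B], since [fact] is monotone. *)
    destruct (greedy_exists (fact b B l + 1)) as [F HF].
    (* Large enough for the candidate [x = b + 1] and all entries [pair (pair t x) d] that matter
       below [l]. The column of [w] at this [x] has a code [u < B], and [w] shows the fact for this
       [u] although it was to be refuted. *)
    pose (m := pair (pair l (b + 1)) l + 1).
    destruct (HB m) as [B' Hm].
    destruct (greedy_can_refute HF 0 Hm) as (w & _ & Hw & Rw).
    destruct (finite_comprehension (O := O) (A := fun i => exists t, t < i + 1 /\
      exists d, d < i + 1 /\ (i = pair t d /\ El (pair (pair t (b + 1)) d) w)) l) as [u0 Hu0].
    { apply (Ind_le (m := 2)); [lia|exact HI]. }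
    { unfold pair. def. }
    destruct (Hl u0) as (u & Lu & Au).
    assert (Lf : fact b u l < fact b B l + 1).
    { apply lt_succ_le. unfold fact. repeat apply pair_le; try apply le_refl. now apply lt_le. }
    apply (Rw (fact b u l) Lf).
    + apply (refuted_iff HF Lf), R.
    + apply shows_fact_iff. exists (b + 1). split; [|split; [apply lt_succ_diag|]].
      * apply lt_succ_le. apply le_trans with (pair l (b + 1)); [apply le_pair_r|apply le_pair_l].
      * intros i Li t Lt d Ld E. apply lt_succ_le in Lt, Ld. apply lt_le in Li as Li'. split.
        -- apply lt_succ_le. repeat apply pair_le; try apply le_refl; eauto using le_trans.
        -- rewrite (Au i Li), (Hu0 i Li). split.
           ++ intros (t' & _ & d' & _ & E' & H). rewrite E in E'.
              apply pair_inj in E' as [-> ->]. exact H.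
           ++ intros H. exists t. split; [now apply lt_succ_le|].
              exists d. split; [now apply lt_succ_le|auto].
  - intros b u l b' u' l' H Lb Ll A R.
    destruct (common_bound (fact b u l) (fact b' u' l')) as (s & L1 & L2).
    destruct (greedy_exists (s + 1)) as [F HF]. apply lt_succ_le in L1, L2.
    destruct (jump_shown HF L1 H) as (w & m & Hw & Rw & x & Lx & Lbx & S).
    (* The [x] that shows the stronger fact also shows the weaker one, which [w] was supposed to
       refute. *)
    apply (Rw _ L2); [exact (proj1 (refuted_iff HF L2) R)|].
    apply shows_fact_iff. exists x. split; [exact Lx|]. split; [exact (le_lt_trans Lb Lbx)|].
    intros i Li t Lt d Ld E. rewrite (A i Li). apply S; trivial. exact (lt_le_trans Li Ll).
  - intros b u l t H V Hd. destruct (greedy_exists (fact b u l + 1)) as [F HF].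
    destruct (jump_shown HF (lt_succ_diag _) H) as (w & m & Hw & Rw & x & Lx & Lbx & S).
    assert (P : forall d, d < k -> pair (pair t x) d < m /\
      (El (pair t d) u <-> El (pair (pair t x) d) w)).
    { intros d Ld. apply (S _ (Hd d Ld)); try apply lt_succ_le; auto using le_pair_l, le_pair_r. }
    (* The colour of [t] in the projection is the colour that [w] gives to [t] followed by the shown
       [x]. *)
    destruct (state_color HN (t := pair t x) (Hw 0)) as (d & Ld & Ed).
    + exists t, x. auto.
    + intros d Ld. now apply P.
    + exists d. split; [exact Ld|]. now apply P.
Qed.

Lemma jump_infinite u l t d : (forall b, jump b u l) -> pair t d < l -> El (pair t d) u ->
  forall b, exists x, b < x /\
    exists w m, (forall b, N b w m) /\ pair (pair t x) d < m /\ El (pair (pair t x) d) w.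
Proof.
  intros HJ L E b. destruct (greedy_exists (fact b u l + 1)) as [F HF].
  destruct (jump_shown HF (lt_succ_diag _) (HJ b)) as (w & m & Hw & Rw & x & Lx & Lbx & S).
  exists x. split; [exact Lbx|]. exists w, m. split; [exact Hw|].
  assert (P : pair (pair t x) d < m /\ (El (pair t d) u <-> El (pair (pair t x) d) w)).
  { apply (S _ L); try apply lt_succ_le; auto using le_pair_l, le_pair_r. }
  split; [apply P|]. now apply P.
Qed.

End Jump.

Lemma state_infs r : forall (O : oracles M) N k, Ind O (S r) ->
  D0 O (fun e => N (e 0%nat) (e 1%nat) (e 2%nat)) ->
  D0 O (fun e => code_bound (e 0%nat) (e 1%nat)) ->
  (forall m, exists B, code_bound m B) -> state k r N ->
  exists d, d < k /\ infs r (fun t =>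
    exists w m, (forall b, N b w m) /\ pair t d < m /\ El (pair t d) w) 0.
Proof.
  induction r as [|r IH]; intros O N k HI DN DB HB HN.
  (* The empty tuple has code 0, and this [m] exceeds [pair 0 d] for every colour [d < k]. *)
  - pose (m := pair 0 k + 1). destruct (HB m) as [B Hm].
    destruct (state_compact (Z := fun _ => True) (m := m) (B := B) (Ind_Coll HI) DN
      (D0_true O) HN) as (w & _ & Hw & _).
    { intros b. destruct (state_bounded b HN Hm) as (w & L & Hw). eauto. }
    assert (P : forall d, d < k -> pair 0 d < m).
    { intros d L. apply lt_succ_le, pair_le; [apply le_refl|now apply lt_le]. }
    destruct (state_color HN (t := 0) (Hw 0) eq_refl P) as (d & Ld & Ed).
    exists d. split; [exact Ld|]. exists w, m. auto.
  - assert (HI2 : Ind O 2) by (apply (Ind_le (m := S (S r))); [lia|exact HI]).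
    (* [code_bound], with a dummy third argument, is carried along so that [can_refute] is again
       Pi_1 at the next stage. *)
    pose (O' := fun A : D -> D -> D -> Prop =>
      A = jump N \/ A = (fun m B _ => code_bound m B)).
    destruct (IH O' (jump N) k) as (d & Ld & H).
    + apply (Delta2_Ind HI). intros A [-> | ->] b.
      * apply jump_Delta2; assumption.
      * apply D0_hier. exact DB.
    + apply (d_mem (A := jump N)); [now left|tm|tm|tm].
    + apply (d_mem (A := fun m B _ => code_bound m B) (f := fun e => e 0%nat)
        (g := fun e => e 1%nat) (h := fun e => e 0%nat)); [now right|tm|tm|tm].
    + exact HB.
    + now apply (jump_state HI2 DN DB HB).
    + exists d. split; [exact Ld|]. apply infs_snoc. refine (infs_mono _ H).
      intros t (u & l & HJ & L & E). exact (jump_infinite HI2 DN DB HN HJ L E).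
Qed.

(** * Elementary indecomposability in a model *)

Fixpoint prolongs (n : nat) (s t : D) : Prop :=
  match n with
  | 0 => t = s
  | S n => exists t', t' < t + 1 /\ exists x, x < t + 1 /\ (t = pair t' x /\ prolongs n s t')
  end.

(** Colourings have arity [n + 1]. *)
Record coloring (n : nat) (k : D) (C : D -> Prop) : Prop := Coloring {
  coloring_graph : forall z, C z -> exists s t y, prolongs n s t /\ y < k /\ z = pair t y;
  coloring_total : forall s t, prolongs n s t -> exists y, C (pair t y);
  coloring_functional : forall s t y y', prolongs n s t ->
    C (pair t y) -> C (pair t y') -> y = y'
}.

(** The outermost quantifier stands apart because a 1-tuple is its bare entry: [infs] starts from
    [x], not from a pair. *)
Definition indecomposable (n : nat) : Prop := forall k C, s_sets C -> coloring n k C ->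
  exists d, d < k /\ forall b, exists x, b < x /\ infs n (fun t => C (pair t d)) x.

Lemma prolongs_S n s t x : prolongs n s t -> prolongs (S n) s (pair t x).
Proof.
  intros H. exists t. split; [apply lt_succ_le, le_pair_l|].
  exists x. split; [apply lt_succ_le, le_pair_r|auto].
Qed.

Lemma prolongs_S_inv n s t x : prolongs (S n) s (pair t x) -> prolongs n s t.
Proof. intros (t' & _ & x' & _ & E & H). apply pair_inj in E as [-> ->]. exact H. Qed.

(** [t] is the tuple [y] of [n + 1] entries with a zero put in front. *)
Fixpoint padded (n : nat) (t y : D) : Prop :=
  match n with
  | 0 => t = pair 0 y
  | S n => exists t', t' < t + 1 /\ exists x, x < t + 1 /\ exists y', y' < y + 1 /\
      (t = pair t' x /\ (y = pair y' x /\ padded n t' y'))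
  end.

Lemma padded_S n t y x : padded n t y -> padded (S n) (pair t x) (pair y x).
Proof.
  intros H. exists t. split; [apply lt_succ_le, le_pair_l|].
  exists x. split; [apply lt_succ_le, le_pair_r|].
  exists y. split; [apply lt_succ_le, le_pair_l|auto].
Qed.

Lemma padded_unique n : forall t y y', padded n t y -> padded n t y' -> y = y'.
Proof.
  induction n as [|n IH]; intros t y y'.
  - intros E E'. rewrite E in E'. now apply pair_inj in E'.
  - intros (t1 & _ & x1 & _ & y1 & _ & -> & -> & H1) (t2 & _ & x2 & _ & y2 & _ & E & -> & H2).
    apply pair_inj in E as [<- <-]. f_equal. eauto.
Qed.

Lemma padded_le n : forall t y, padded n t y -> y <= t.
Proof.
  induction n as [|n IH]; intros t y.
  - intros ->. apply le_pair_r.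
  - intros (t1 & _ & x1 & _ & y1 & _ & -> & -> & H1). apply pair_le; [auto|apply le_refl].
Qed.

Lemma padded_prolongs n : forall t y, padded n t y -> exists s, prolongs n s y.
Proof.
  induction n as [|n IH]; intros t y.
  - intros _. now exists y.
  - intros (t1 & _ & x1 & _ & y1 & _ & -> & -> & H1). destruct (IH _ _ H1) as [s Hs].
    exists s. now apply prolongs_S.
Qed.

Lemma valid_padded n : forall t x, valid n t -> exists y, padded n (pair t x) y.
Proof.
  induction n as [|n IH]; intros t x V.
  - simpl in V. subst t. now exists x.
  - destruct V as (t' & x' & -> & V). destruct (IH t' x' V) as [y H].
    exists (pair y x). now apply padded_S.
Qed.

Lemma D0_padded n O (f g : env -> D) : Tm f -> Tm g -> D0 O (fun e => padded n (f e) (g e)).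
Proof.
  apply (hier_2 (n := 0) (b := true) (P := padded n)). simpl.
  induction n as [|n IH]; unfold padded; fold padded; unfold pair in *; def.
Qed.

Lemma infs_padded d (C : D -> Prop) n : forall j t y, padded j t y ->
  infs n (fun t => exists y, y < t + 1 /\ (padded (n + j) t y /\ C (pair y d))) t ->
  infs n (fun y => C (pair y d)) y.
Proof.
  induction n as [|n IH]; intros j t y H.
  - intros (y' & _ & H' & K). now rewrite (padded_unique H H').
  - intros K b. destruct (K b) as (x & L & G). exists x. split; [exact L|].
    apply (IH (S j) _ _ (padded_S x H)). rewrite Nat.add_succ_r. exact G.
Qed.

Lemma D0_set (C : D -> Prop) (f : env -> D) : s_sets C -> Tm f ->
  D0 (set_oracles (M := M)) (fun e => C (f e)).
Proof.
  intros HC Hf. refine (d_mem (A := fun x _ _ => C x) _ Hf Hf Hf). exists C. auto.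
Qed.

Lemma Ind_indecomposable n : Ind (set_oracles (M := M)) (S (S n)) -> indecomposable n.
Proof.
  intros HI k C SC HC.
  pose (O := set_oracles (M := M)). fold O in HI.
  (* The zero put in front makes even a 1-tuple a pair, so that the last argument can be removed
     uniformly down to the empty tuple. *)
  pose (R := fun t d => exists y, y < t + 1 /\ (padded n t y /\ C (pair y d))).
  pose (N := fun b w m => exists x, b < x /\ forall i, i < m -> forall t, t < i + 1 ->
    forall d, d < i + 1 -> i = pair t d -> (El i w <-> R (pair t x) d)).
  assert (DC : D0 O (fun e => C (e 0%nat))) by (apply D0_set; [exact SC|tm]).
  assert (DR : D0 O (fun e => R (e 0%nat) (e 1%nat))).
  { unfold R. apply d_bex'; [tm|]. apply d_and; [apply D0_padded; tm|]. unfold pair. def. }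
  assert (I2 : Ind O 2) by (apply (Ind_le (m := S (S n))); [lia|exact HI]).
  assert (I2' : Ind (no_oracles (M := M)) 2) by (apply (Ind_mono (O' := O)); [easy|exact I2]).
  assert (HN : state k n N).
  { constructor.
    - intros b m.
      destruct (finite_comprehension (O := O) (A := fun i => exists t, t < i + 1 /\
        exists d, d < i + 1 /\ (i = pair t d /\ R (pair t (b + 1)) d)) m) as [w Hw].
      { apply (Ind_le (m := 2)); [lia|exact I2]. }
      { unfold pair. def. }
      exists w, (b + 1). split; [apply lt_succ_diag|]. intros i Li t Lt d Ld E.
      rewrite (Hw i Li). split.
      + intros (t' & _ & d' & _ & E' & H). rewrite E in E'. now apply pair_inj in E' as [-> ->].
      + intros H. exists t. split; [exact Lt|]. exists d. auto.
    - intros b w m b' w' m' (x & Lx & H) Lb Lm A. exists x.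
      split; [exact (le_lt_trans Lb Lx)|]. intros i Li t Lt d Ld E.
      rewrite (A i Li). apply H; trivial. exact (lt_le_trans Li Lm).
    - intros b w m t (x & Lx & H) V P. destruct (valid_padded x V) as [y Hy].
      destruct (padded_prolongs Hy) as [s Hs]. destruct (coloring_total HC Hs) as [d Hd].
      destruct (coloring_graph HC Hd) as (s' & t' & d' & _ & Ld & E).
      apply pair_inj in E as [_ <-].
      exists d. split; [exact Ld|].
      refine (proj2 (H _ (P d Ld) t _ d _ eq_refl) _);
        [apply lt_succ_le, le_pair_l|apply lt_succ_le, le_pair_r|].
      exists y. split; [|auto]. apply lt_succ_le. exact (padded_le Hy). }
  pose (O' := fun A : D -> D -> D -> Prop => A = N \/ A = (fun m B _ => code_bound m B)).
  destruct (state_infs (O := O') (r := n) (N := N) (k := k)) as (d & Ld & H).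
  - apply (Delta2_Ind HI). intros A HA b.
    (* The initial facts are Sigma_1 and [code_bound] is Pi_1; either way they are Delta_2, which
       pays the first level of induction. *)
    assert (K : exists b, hier O b 1 (fun e => A (e 0%nat) (e 1%nat) (e 2%nat))).
    { destruct HA as [-> | ->].
      - exists true. apply (hier_ex (Q := fun x e => e 0%nat < x /\ forall i, i < e 2%nat ->
          forall t, t < i + 1 -> forall d, d < i + 1 -> i = pair t d ->
          (El i (e 1%nat) <-> R (pair t x) d))).
        simpl. unfold pair. def.
      - exists false. apply (hier_all (Q := fun w e => exists w', w' < e 1%nat /\
          agree (e 0%nat) w' w)). simpl. unfold agree. def. }
    destruct K as [b' K]. destruct (Bool.bool_dec b b') as [->|Nb].
    + now apply hier_S.
    + replace b with (negb b') by now destruct b, b'. now apply hier_dual.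
  - apply (d_mem (A := N)); [now left|tm|tm|tm].
  - apply (d_mem (A := fun m B _ => code_bound m B) (f := fun e => e 0%nat)
      (g := fun e => e 1%nat) (h := fun e => e 0%nat)); [now right|tm|tm|tm].
  - intros m. now apply code_bound_exists.
  - exact HN.
  - exists d. split; [exact Ld|].
    assert (G : infs (S n) (fun t => R t d) 0).
    { apply infs_snoc. refine (infs_mono _ H). intros t (w & m & Hw & L & E) b.
      destruct (Hw b) as (x & Lx & Hx). exists x. split; [exact Lx|].
      refine (proj1 (Hx _ L t _ d _ eq_refl) E);
        [apply lt_succ_le, le_pair_l|apply lt_succ_le, le_pair_r]. }
    intros b. destruct (G b) as (x & Lx & K). exists x. split; [exact Lx|].
    apply (infs_padded (j := 0) (t := pair 0 x)); [reflexivity|].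
    rewrite Nat.add_0_r. exact K.
Qed.

(** * Collection from indecomposability *)

Lemma prolongs_cons n : forall s x t, prolongs n (pair s x) t -> prolongs (S n) s t.
Proof.
  induction n as [|n IH]; intros s x t.
  - intros ->. now apply prolongs_S.
  - intros (t' & _ & x' & _ & -> & H). apply prolongs_S. exact (IH _ _ _ H).
Qed.

Lemma prolongs_S_split n : forall s t, prolongs (S n) s t -> exists x, prolongs n (pair s x) t.
Proof.
  induction n as [|n IH]; intros s t (t' & _ & x & _ & -> & P).
  - exists x. simpl in P. now subst t'.
  - destruct (IH _ _ P) as [x' H]. exists x'. now apply prolongs_S.
Qed.

Lemma prolongs_unique n : forall s s' t, prolongs n s t -> prolongs n s' t -> s = s'.
Proof.
  induction n as [|n IH]; intros s s' t.
  - now intros -> ->.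
  - intros (t1 & _ & x1 & _ & -> & H1) H2. apply prolongs_S_inv in H2. eauto.
Qed.

Lemma prolongs_le n : forall s t, prolongs n s t -> s <= t.
Proof.
  induction n as [|n IH]; intros s t.
  - intros ->. apply le_refl.
  - intros (t1 & _ & x1 & _ & -> & H). apply le_trans with t1; [auto|apply le_pair_l].
Qed.

Lemma D0_prolongs n O (f g : env -> D) : Tm f -> Tm g ->
  D0 O (fun e => prolongs n (f e) (g e)).
Proof.
  apply (hier_2 (n := 0) (b := true) (P := prolongs n)). simpl.
  induction n as [|n IH]; unfold prolongs; fold prolongs; unfold pair in *; def.
Qed.

Lemma infs_snoc_inv n (S : D -> Prop) : forall t,
  infs (Datatypes.S n) S t -> infs n (fun t => forall b, exists x, b < x /\ S (pair t x)) t.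
Proof.
  induction n as [|n IH]; intros t H; [exact H|].
  intros b. destruct (H b) as (x & L & G). exists x. split; [exact L|]. exact (IH _ G).
Qed.

Fixpoint evs (n : nat) (S : D -> Prop) (t : D) : Prop :=
  match n with
  | 0 => S t
  | Datatypes.S n => exists b, forall x, b < x -> evs n S (pair t x)
  end.

Lemma evs_mono n (S S' : D -> Prop) : forall t,
  (forall t', prolongs n t t' -> S t' -> S' t') -> evs n S t -> evs n S' t.
Proof.
  induction n as [|n IH]; intros t H.
  - apply H. reflexivity.
  - intros [b K]. exists b. intros x L. apply IH; [|exact (K x L)].
    intros t' P. apply H. exact (prolongs_cons P).
Qed.

Lemma infs_evs n (S S' : D -> Prop) : forall t, infs n S t -> evs n S' t ->
  exists t', prolongs n t t' /\ S t' /\ S' t'.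
Proof.
  induction n as [|n IH]; intros t H H'.
  - exists t. split; [reflexivity|auto].
  - destruct H' as [b H']. destruct (H b) as (x & L & G).
    destruct (IH _ G (H' x L)) as (t' & P & K). exists t'. split; [|exact K].
    exact (prolongs_cons P).
Qed.

(** Collection is applied to the implication from [exists z, R z u] to [R y u], which is Pi_(n+1)
    and always has a witness; 0 serves where the premise fails. *)
Lemma strong_collection O n (R : D -> D -> Prop) U : Coll O (S n) ->
  hier O false n (fun e => R (e 0%nat) (e 1%nat)) ->
  exists b, forall u, u < U -> (exists z, R z u) -> exists z, z < b /\ R z u.
Proof.
  intros C HR. destruct (C (fun u y => (exists z, R z u) -> R y u)) with (a := U) as [b Hb].
  - apply hier_imp.
    + apply (hier_ex (Q := fun z e => R z (e 0%nat))). apply (hier_2 HR); tm.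
    + apply hier_S. apply (hier_2 HR); tm.
  - intros u _. destruct (classic (exists z, R z u)) as [[z H]|H].
    + now exists z.
    + exists 0. tauto.
  - exists b. intros u L H. destruct (Hb u L) as (y & Ly & Hy). exists y. auto.
Qed.

(** Bounding the quantifiers of [Q] by the last [n] entries of [t] gives a
    Delta_0 approximation; its iterated limit is [Q], uniformly on bounded sets. *)
Lemma approximation O n : Coll O n -> forall b (Q : D -> Prop),
  hier O b n (fun e => Q (e 0%nat)) ->
  exists A : D -> D -> Prop, D0 O (fun e => A (e 0%nat) (e 1%nat)) /\
    forall U t, evs n (fun t' => forall u, u < U -> (A t' u <-> Q u)) t.
Proof.
  induction n as [|n IH]; intros C b Q HQ.
  - exists (fun _ u => Q u). split.
    + apply (hier_1 (n := 0) (b := true) HQ). tm.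
    + intros U t u _. reflexivity.
  - assert (C' : Coll O n) by (apply (Coll_le (m := S n)); [lia|exact C]).
    assert (T : forall Q : D -> Prop, hier O true (S n) (fun e => Q (e 0%nat)) ->
      exists A : D -> D -> Prop, D0 O (fun e => A (e 0%nat) (e 1%nat)) /\
        forall U t, evs (S n) (fun t' => forall u, u < U -> (A t' u <-> Q u)) t).
    { clear b Q HQ. intros Q (R' & HR' & E).
      pose (R := fun z u => R' (scons z (fun _ => u))).
      assert (ER : forall u, Q u <-> exists z, R z u).
      { intros u. change (Q u) with ((fun e => Q (e 0%nat)) (fun _ => u)). rewrite E.
        reflexivity. }
      assert (HR : hier O false n (fun e => R (e 0%nat) (e 1%nat))).
      { refine (hier_ext (hier_subst (ts := scons (fun e => e 0%nat) (fun _ e => e 1%nat)) HR' _) _).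
        - intros [|i]; [exact (tm_var 0)|exact (tm_var 1)].
        - intros e. unfold R.
          match goal with |- R' ?a <-> R' ?b => replace b with a; [reflexivity|] end.
          apply functional_extensionality. now intros [|i]. }
      destruct (IH C' false (fun v => R (fst (unpair v)) (snd (unpair v)))) as (A' & DA & HA).
      { exact (hier_pull HR (unpair_admissible (O := O))). }
      (* [s] is the first of the last [n + 1] entries of [t]. It bounds the leading quantifier [z],
         and the entries after it serve [A']. *)
      exists (fun t u => exists s, s < t + 1 /\ ((exists t0, t0 < t + 1 /\
        prolongs n (pair t0 s) t) /\ exists z, z < s /\ A' t (pair z u))).
      split.
      { apply d_bex'; [tm|]. apply d_and.
        - apply d_bex'; [tm|]. apply D0_prolongs; unfold pair; tm.
        - unfold pair. def. }
      intros U t. destruct (strong_collection U C HR) as [b Hb].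
      exists b. intros s Ls.
      (* Every code [pair z u] with [z < s] and [u < U] lies below this bound; [s > b] ensures that
         a witness below [s] exists whenever there is any. *)
      refine (evs_mono _ (HA (pair s U + 1) (pair t s))). intros t' P H u Lu.
      rewrite ER.
      assert (K : forall z, z < s -> (A' t' (pair z u) <-> R z u)).
      { intros z Lz. rewrite H, unpair_pair; [reflexivity|].
        apply lt_succ_le, pair_le; now apply lt_le. }
      split.
      - intros (s' & _ & (t0 & _ & P') & z & Lz & G).
        pose proof (prolongs_unique P P') as Es. apply pair_inj in Es as [_ <-].
        exists z. now apply K.
      - intros G. destruct (Hb u Lu G) as (z & Lz & Hz).
        pose proof (prolongs_le P) as Lt.
        exists s. split; [apply lt_succ_le; exact (le_trans (le_pair_r t s) Lt)|]. split.
        + exists t. split; [apply lt_succ_le; exact (le_trans (le_pair_l t s) Lt)|exact P].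
        + assert (Lzs : z < s) by exact (lt_trans Lz Ls).
          exists z. split; [exact Lzs|]. now apply K. }
    destruct b; [auto|].
    apply (hier_not (b := true)) in HQ.
    destruct (T (fun u => ~ Q u) HQ) as (A & DA & HA).
    exists (fun t u => ~ A t u). split; [unfold not; def|].
    intros U t. refine (evs_mono _ (HA U t)). intros t' _ H u L.
    rewrite (H u L). split; [apply NNPP|tauto].
Qed.

Lemma least O (P : D -> Prop) : Ind O 1 -> D0 O (fun e => P (e 0%nat)) ->
  forall x, P x -> exists y, P y /\ y <= x /\ forall z, z < y -> ~ P z.
Proof.
  intros HI HP x Hx. apply NNPP. intros N.
  assert (K : forall c, forall y, y < c -> y < x + 1 -> ~ P y).
  { intros c. pattern c. apply HI; clear c.
    - apply D0_hier. unfold not. def.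
    - intros y L. now apply nlt_0_r in L.
    - intros c IH y L Lx Hy. apply lt_succ in L as [L| ->]; [now apply (IH y)|].
      apply N. exists c. split; [exact Hy|]. split; [now apply lt_succ_le|].
      intros z Lz. apply IH; [exact Lz|exact (lt_trans Lz Lx)]. }
  exact (K (x + 1) x (lt_succ_diag x) (lt_succ_diag x) Hx).
Qed.

(** Needed to unpair twice, for codes of triples [pair z (pair x y)]. *)
Lemma admissible_under O F : admissible O F -> admissible O (under (M := M) 1 F).
Proof. intros HF P HP j. rewrite under_comm. exact (HF P HP (S j)). Qed.

Section Collection.
Notation O := (set_oracles (M := M)).
Hypothesis HI : Ind O 1.
Hypothesis HC : forall P : D -> Prop, D0 O (fun e => P (e 0%nat)) -> s_sets P.

(** A dummy last argument is added to the colouring; one value of the innermost quantifier then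
    suffices to recover the original colour. *)
Lemma indecomposable_pred n : indecomposable (S n) -> indecomposable n.
Proof.
  intros H k C SC [G T F].
  assert (DC : D0 O (fun e => C (e 0%nat))) by (apply D0_set; [exact SC|tm]).
  destruct (H k (fun z => exists t, t < z + 1 /\ exists x, x < z + 1 /\ exists d, d < z + 1 /\
    (z = pair (pair t x) d /\ C (pair t d)))) as (d & Ld & K).
  - apply HC. unfold pair. def.
  - constructor.
    + intros z (t & _ & x & _ & d & _ & -> & Hz).
      destruct (G _ Hz) as (s & t' & y & P & Ly & E). apply pair_inj in E as [<- <-].
      exists s, (pair t x), d. split; [now apply prolongs_S|auto].
    + intros s t (t' & _ & x & _ & -> & P). destruct (T s t' P) as [y Hy].
      exists y, t'. split.
      { apply lt_succ_le. apply le_trans with (pair t' x); apply le_pair_l. }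
      exists x. split.
      { apply lt_succ_le. apply le_trans with (pair t' x); [apply le_pair_r|apply le_pair_l]. }
      exists y. split; [apply lt_succ_le, le_pair_r|auto].
    + intros s t y y' P (t1 & _ & x1 & _ & d1 & _ & E1 & H1) (t2 & _ & x2 & _ & d2 & _ & E2 & H2).
      apply pair_inj in E1 as [-> ->]. apply pair_inj in E2 as [E2 ->].
      apply pair_inj in E2 as [<- <-]. apply prolongs_S_inv in P.
      exact (F s t1 _ _ P H1 H2).
  - exists d. split; [exact Ld|]. intros b. destruct (K b) as (x & Lx & Hx).
    exists x. split; [exact Lx|]. apply infs_snoc_inv in Hx.
    refine (infs_mono _ Hx). intros t Ht. destruct (Ht 0) as (x' & _ & t1 & _ & x1 & _ & d1 & _ & E & G1).
    apply pair_inj in E as [E ->]. apply pair_inj in E as [-> _]. exact G1.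
Qed.

Lemma indecomposable_Coll n : indecomposable n -> Coll O n -> Coll O (S n).
Proof.
  intros HE C P HP a Ha.
  (* Colours are the numbers below [a], so [a] must be positive. *)
  destruct (zero_or_succ a) as [->|[a' Ea]].
  { exists 0. intros x L. now apply nlt_0_r in L. }
  assert (La : 0 < a) by (rewrite Ea; apply lt_succ_le, le_0_l).
  destruct HP as (R' & HR' & EP).
  pose (R := fun z x y => R' (scons z (scons x (fun _ => y)))).
  assert (ER : forall x y, P x y <-> forall z, R z x y).
  { intros x y. change (P x y) with
      ((fun e => P (e 0%nat) (e 1%nat)) (scons x (fun _ => y))).
    rewrite EP. reflexivity. }
  assert (HR : hier O true n (fun e => R (e 0%nat) (e 1%nat) (e 2%nat))).
  { refine (hier_ext (hier_subst (ts := scons (fun e => e 0%nat) (scons (fun e => e 1%nat)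
      (fun _ e => e 2%nat))) HR' _) _).
    - intros [|[|i]]; [exact (tm_var 0)|exact (tm_var 1)|exact (tm_var 2)].
    - intros e. unfold R.
      match goal with |- R' ?a <-> R' ?b => replace b with a; [reflexivity|] end.
      apply functional_extensionality. now intros [|[|i]]. }
  destruct (approximation C (b := true) (Q := fun v => R (fst (unpair v))
    (fst (unpair (snd (unpair v)))) (snd (unpair (snd (unpair v)))))) as (A & DA & HA).
  { pose proof (unpair_admissible (O := O)) as U.
    exact (hier_pull (hier_pull HR (admissible_under U)) U). }
  pose (B := fun t s x y => forall z, z < s -> A t (pair z (pair x y))).
  pose (Mu := fun t s v => forall x, x < a -> exists y, y < v + 1 /\ B t s x y).
  (* [d] qualifies if each of its apparent witnesses up to [s] already bounds apparent witnesses for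
     all [x < a]; with no apparent witness up to [s] it qualifies vacuously. *)
  pose (W := fun t s d => forall y, y < s + 1 -> B t s d y -> Mu t s y).
  assert (DW : D0 O (fun e => W (e 0%nat) (e 1%nat) (e 2%nat))).
  { unfold W, Mu, B, pair. def. }
  assert (HW : forall t s, exists d, d < a /\ W t s d).
  { intros t s. apply NNPP. intros N.
    (* If [v] bounds apparent witnesses for all [x < a], the current [d], having none below [v],
       qualifies; if not, a failing [x] has none up to [v] and replaces [d]. At [v = s + 1] the
       result qualifies vacuously. *)
    assert (K : forall v, exists d, d < a /\ forall y, y < v -> ~ B t s d y).
    { apply HI.
      - apply D0_hier. unfold B, pair, not. def.
      - exists 0. split; [exact La|]. intros y L. now apply nlt_0_r in L.
      - intros v (d & Ld & Hd). destruct (classic (Mu t s v)) as [G|G].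
        + destruct N. exists d. split; [exact Ld|]. intros y _ Hy x Lx.
          destruct (G x Lx) as (y' & Ly' & Hy'). exists y'. split; [|exact Hy'].
          destruct (le_or_lt v y) as [L|L]; [|now apply Hd in Hy].
          apply lt_succ_le. apply lt_succ_le in Ly'. exact (le_trans Ly' L).
        + apply not_all_ex_not in G as [x G]. apply imply_to_and in G as [Lx G].
          exists x. split; [exact Lx|]. intros y Ly Hy. apply G. exists y. auto. }
    destruct (K (s + 1)) as (d & Ld & Hd). apply N. exists d. split; [exact Ld|].
    intros y Ly Hy. now apply Hd in Hy. }
  (* Taking the least qualifying [d] makes the colouring single-valued. *)
  destruct (HE a (fun z => exists s, s < z + 1 /\ exists t, t < z + 1 /\ exists d, d < z + 1 /\
    (z = pair t d /\ (prolongs n s t /\ (d < a /\ (W t s d /\ forall d', d' < d -> ~ W t s d'))))))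
    as (d & Ld & Hd).
  - apply HC. repeat (apply d_bex'; [tm|]). apply d_and; [unfold pair; def|].
    apply d_and; [apply D0_prolongs; tm|]. unfold not. def.
  - constructor.
    + intros z (s & _ & t & _ & d & _ & E & Pr & Ld & _). exists s, t, d. auto.
    + intros s t Pr. destruct (HW t s) as (d0 & Ld0 & Hd0).
      destruct (least (P := W t s) HI) with (x := d0) as (d & Hd & Ld & Hmin).
      * apply (hier_3 (n := 0) (b := true) DW); tm.
      * exact Hd0.
      * exists d, s. split.
        { apply lt_succ_le. apply le_trans with t; [exact (prolongs_le Pr)|apply le_pair_l]. }
        exists t. split; [apply lt_succ_le, le_pair_l|].
        exists d. split; [apply lt_succ_le, le_pair_r|].
        repeat split; auto. exact (le_lt_trans Ld Ld0).
    + intros s0 t0 y y' _ (s & _ & t & _ & d & _ & E & Pr & _ & Hd & Hm)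
        (s' & _ & t' & _ & d' & _ & E' & Pr' & _ & Hd' & Hm').
      apply pair_inj in E as [-> ->]. apply pair_inj in E' as [<- ->].
      rewrite <- (prolongs_unique Pr Pr') in Hd', Hm'.
      destruct (le_or_lt d d') as [L|L]; [apply lt_or_eq in L as [L|L]|]; trivial.
      * now apply Hm' in L.
      * now apply Hm in L.
  - destruct (Ha d Ld) as [Y HY]. rewrite ER in HY.
    assert (K : forall b, exists s, b < s /\
      forall x, x < a -> exists y, y < Y + 1 /\ forall z, z < s -> R z x y).
    { intros b. destruct (common_bound b Y) as (c & Lb & LY).
      destruct (Hd c) as (s & Ls & Hs).
      exists s. split; [exact (le_lt_trans Lb Ls)|].
      (* The colour recurs infinitely often and the approximation is eventually correct on all
         triples with [z < s], [x < a], [y <= Y], so both hold at a common [t]. *)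
      destruct (infs_evs Hs (HA (pair s (pair a Y) + 1) s)) as (t & Pr & Ht & E).
      destruct Ht as (s' & _ & t' & _ & d' & _ & Et & Pr' & _ & HWd & _).
      apply pair_inj in Et as [<- <-]. rewrite <- (prolongs_unique Pr Pr') in HWd.
      assert (EA : forall z x y, z < s -> x < a -> y < Y + 1 ->
        (A t (pair z (pair x y)) <-> R z x y)).
      { intros z x y Lz Lx Ly. rewrite E, !unpair_pair; simpl; rewrite ?unpair_pair;
          [reflexivity|].
        apply lt_succ_le. repeat apply pair_le; try now apply lt_le. now apply lt_succ_le. }
      assert (M0 : Mu t s Y).
      { apply HWd.
        - apply lt_succ_le, lt_le, (le_lt_trans LY Ls).
        - intros z Lz. apply EA; trivial. apply lt_succ_diag. }
      intros x Lx. destruct (M0 x Lx) as (y & Ly & Hy). exists y. split; [exact Ly|].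
      intros z Lz. apply EA; auto. }
    exists (Y + 1). intros x Lx. apply NNPP. intros N.
    (* If no [y <= Y] were a true witness for [x], collection would bound the counterexamples by
       some [b]; an [s > b] exposes all of them. *)
    destruct (C (fun y z => ~ R z x y)) with (a := Y + 1) as [b Hb].
    + apply hier_not. apply (hier_3 HR); tm.
    + intros y Ly. apply not_all_ex_not. intros G. apply N. exists y.
      split; [exact Ly|]. now apply ER.
    + destruct (K b) as (s & Ls & Hs). destruct (Hs x Lx) as (y & Ly & Hy).
      destruct (Hb y Ly) as (z & Lz & Hz). apply Hz, Hy. exact (lt_trans Lz Ls).
Qed.

Lemma indecomposable_all_Coll n : indecomposable n -> Coll O (S n).
Proof.
  induction n as [|n IH]; intros H.
  - apply (indecomposable_Coll H). now apply Ind_Coll.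
  - apply (indecomposable_Coll H), IH, indecomposable_pred, H.
Qed.

End Collection.

(** * Reading the formulas *)

Lemma tuple_vars_S a n : tuple (vars a (S (S n))) = Pair (tuple (vars (S a) (S n))) (Var a).
Proof.
  unfold vars. change (seq a (S (S n))) with (a :: seq (S a) (S n)).
  simpl rev at 1. rewrite map_app.
  assert (H : map Var (rev (seq (S a) (S n))) <> []).
  { intros H. apply (f_equal (@length term)) in H.
    rewrite length_map, length_rev, length_seq in H. discriminate. }
  change (rev (seq (S (S a)) n) ++ [S a]) with (rev (seq (S a) (S n))).
  destruct (map Var (rev (seq (S a) (S n)))) as [|t l]; [easy|].
  simpl. now rewrite fold_left_app.
Qed.

Lemma teval_vars_scons x (e : env) n : forall a,
  teval (scons x e) (tuple (vars (S a) n)) = teval e (tuple (vars a n)).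
Proof.
  destruct n as [|n]; [reflexivity|].
  induction n as [|n IH]; intros a; [reflexivity|].
  rewrite !tuple_vars_S. simpl. now rewrite IH.
Qed.

Section Quantifier.
Variable Q : (D -> Prop) -> Prop.

(** Generic in [Q], so that blocks of [fEx], [fAll] and [fExInf] are decoded once. Nothing is
    assumed of [Q], hence the lemmas give equalities of propositions, which can be rewritten under
    it. *)
Fixpoint iter_env (n : nat) (F : env -> Prop) (e : env) : Prop :=
  match n with
  | 0 => F e
  | S n => Q (fun x => iter_env n F (scons x e))
  end.

Fixpoint iter_tuple (n : nat) (S : D -> Prop) (t : D) : Prop :=
  match n with
  | 0 => S t
  | Datatypes.S n => Q (fun x => iter_tuple n S (pair t x))
  end.

(** [j + 1] entries are bound already, and each further quantifier appends one. The count starts at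
    one because only a nonempty tuple extends by pairing. *)
Lemma iter_env_tuple n : forall j (S : D -> env -> Prop) e,
  iter_env n (fun e' => S (teval e' (tuple (vars 0 (n + Datatypes.S j))))
    (fun i => e' (Nat.add n i))) e =
  iter_tuple n (fun t => S t e) (teval e (tuple (vars 0 (Datatypes.S j)))).
Proof.
  induction n as [|n IH]; intros j S e; [reflexivity|].
  cbn [iter_env iter_tuple]. f_equal. apply functional_extensionality. intros x.
  rewrite <- (teval_vars_scons x e (Datatypes.S j) 0).
  change (pair (teval (scons x e) (tuple (vars 1 (Datatypes.S j)))) x) with
    (teval (scons x e) (Pair (tuple (vars 1 (Datatypes.S j))) (Var 0))).
  rewrite <- tuple_vars_S.
  refine (eq_trans _ (IH (Datatypes.S j) (fun t e => S t (fun i => e (Datatypes.S i)))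
    (scons x e))).
  f_equal. apply functional_extensionality. intros e'.
  rewrite !(Nat.add_succ_r n (Datatypes.S j)). cbn [Nat.add]. f_equal.
  apply functional_extensionality. intros i. now rewrite Nat.add_succ_r.
Qed.

Lemma iter_env_full n (S : D -> env -> Prop) e :
  iter_env (Datatypes.S n) (fun e' => S (teval e' (tuple (vars 0 (Datatypes.S n))))
    (fun i => e' (Nat.add (Datatypes.S n) i))) e = Q (iter_tuple n (fun t => S t e)).
Proof.
  cbn [iter_env]. f_equal. apply functional_extensionality. intros x.
  refine (eq_trans _ (iter_env_tuple n 0 (fun t e => S t (fun i => e (Datatypes.S i)))
    (scons x e))).
  f_equal. apply functional_extensionality. intros e'.
  rewrite Nat.add_1_r. cbn [Nat.add]. f_equal. apply functional_extensionality. intros i.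
  now rewrite Nat.add_succ_r.
Qed.

Lemma sat_iter (q : formula -> formula) E
    (Hq : forall e p, sat e E (q p) = Q (fun x => sat (scons x e) E p)) n p : forall e,
  sat e E (Nat.iter n q p) = iter_env n (fun e => sat e E p) e.
Proof.
  induction n as [|n IH]; intros e; [reflexivity|].
  simpl. rewrite Hq. f_equal. apply functional_extensionality. intros x. apply IH.
Qed.

Lemma sat_iter_tuple (S : D -> env -> Prop) (q : formula -> formula) E n p :
  (forall e p, sat e E (q p) = Q (fun x => sat (scons x e) E p)) ->
  (forall e', sat e' E p <->
    S (teval e' (tuple (vars 0 (Datatypes.S n)))) (fun i => e' (Nat.add (Datatypes.S n) i))) ->
  forall e, sat e E (Nat.iter (Datatypes.S n) q p) = Q (iter_tuple n (fun t => S t e)).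
Proof.
  intros Hq H e. rewrite (sat_iter Hq). refine (eq_trans _ (iter_env_full n S e)).
  f_equal. now apply pred_ext.
Qed.

End Quantifier.

Arguments sat_iter_tuple : clear implicits.

Lemma iter_tuple_all n S : forall s,
  iter_tuple (fun P => forall x, P x) n S s <-> forall t, prolongs n s t -> S t.
Proof.
  induction n as [|n IH]; intros s.
  - simpl. split; [now intros H t ->|auto].
  - simpl iter_tuple. split.
    + intros H t P. apply prolongs_S_split in P as [x P]. exact (proj1 (IH _) (H x) t P).
    + intros H x. apply IH. intros t P. apply H. exact (prolongs_cons P).
Qed.

Lemma iter_tuple_ex n S : forall s,
  iter_tuple (fun P => exists x, P x) n S s <-> exists t, prolongs n s t /\ S t.
Proof.
  induction n as [|n IH]; intros s.
  - simpl. split; [intros H; now exists s|now intros (t & -> & H)].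
  - simpl iter_tuple. split.
    + intros [x H]. apply IH in H as (t & P & H). exists t. split; [exact (prolongs_cons P)|exact H].
    + intros (t & P & H). apply prolongs_S_split in P as [x P]. exists x. apply IH. eauto.
Qed.

Lemma sat_fExInf (e : env) E p :
  sat e E (fExInf p) = forall b, exists x, b < x /\ sat (scons x e) E p.
Proof.
  apply propositional_extensionality. unfold fExInf. simpl.
  assert (K : forall b x, sat (scons x (scons b e)) E
      (subst (scons (Var 0) (fun i => Var (S (S i)))) p) <-> sat (scons x e) E p).
  { intros b x. rewrite sat_subst.
    replace (fun i => teval (scons x (scons b e)) (scons (Var 0) (fun i => Var (S (S i))) i))
      with (scons x e); [reflexivity|].
    apply functional_extensionality. now intros [|i]. }
  split; intros H b; destruct (H b) as (x & L & G); exists x; split; trivial; apply (K b); exact G.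
Qed.

Lemma sat_is_coloring n k e X E :
  sat (scons k e) (scons X E) (is_coloring (S n)) <-> coloring n k X.
Proof.
  assert (H1 : forall z, sat (scons z (scons k e)) (scons X E) (Nat.iter (S n) fEx (fEx
      (fAnd (fLt (Var 0) (Var (S n + 2)))
        (fEq (Var (S n + 1)) (Pair (tuple (vars 1 (S n))) (Var 0)))))) <->
      exists s t y, prolongs n s t /\ y < k /\ z = pair t y).
  { intros z. rewrite (sat_iter_tuple (fun P => exists x, P x)
      (fun t g => exists y, y < g 1%nat /\ g 0%nat = pair t y)).
    - split.
      + intros [s H]. apply iter_tuple_ex in H as (t & P & y & Ly & E'). eauto 6.
      + intros (s & t & y & P & Ly & E'). exists s. apply iter_tuple_ex. eauto.
    - reflexivity.
    - intros e'. simpl sat.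
      replace (Nat.add n 2) with (S (S n)) by lia. rewrite Nat.add_0_r, !Nat.add_1_r.
      split; intros [y H]; exists y; rewrite teval_vars_scons in *; exact H. }
  assert (H2 : sat (scons k e) (scons X E) (Nat.iter (S n) fAll
      (fEx (fVal 0 (vars 1 (S n)) (Var 0)))) <->
      forall s t, prolongs n s t -> exists y, X (pair t y)).
  { rewrite (sat_iter_tuple (fun P => forall x, P x)
      (fun t g => exists y, X (pair t y))).
    - split.
      + intros H s. exact (proj1 (iter_tuple_all _ _ _) (H s)).
      + intros H s. exact (proj2 (iter_tuple_all _ _ _) (H s)).
    - reflexivity.
    - intros e'. simpl sat.
      split; intros [y H]; exists y; rewrite teval_vars_scons in *; exact H. }
  assert (H3 : sat (scons k e) (scons X E) (Nat.iter (S n) fAll (fAll (fAll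
       (fImp (fVal 0 (vars 2 (S n)) (Var 1))
          (fImp (fVal 0 (vars 2 (S n)) (Var 0)) (fEq (Var 1) (Var 0))))))) <->
      forall s t, prolongs n s t -> forall y y', X (pair t y) -> X (pair t y') -> y = y').
  { rewrite (sat_iter_tuple (fun P => forall x, P x)
      (fun t g => forall y y', X (pair t y) -> X (pair t y') -> y = y')).
    - split.
      + intros H s. exact (proj1 (iter_tuple_all _ _ _) (H s)).
      + intros H s. exact (proj2 (iter_tuple_all _ _ _) (H s)).
    - reflexivity.
    - intros e'. simpl sat.
      split; intros H y y'; specialize (H y y'); rewrite !teval_vars_scons in *; exact H. }
  split.
  - intros (G & T & F). constructor.
    + intros z Hz. exact (proj1 (H1 z) (G z Hz)).
    + exact (proj1 H2 T).
    + intros s t y y' P. exact (proj1 H3 F s t P y y').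
  - intros [G T F]. split; [|split].
    + intros z Hz. exact (proj2 (H1 z) (G z Hz)).
    + exact (proj2 H2 T).
    + apply (proj2 H3). eauto.
Qed.

Lemma sat_infinitely_often n d (e : env) X E :
  sat (scons d e) (scons X E) (Nat.iter (S n) fExInf (fVal 0 (vars 0 (S n)) (Var (S n)))) <->
  forall b, exists x, b < x /\ infs n (fun t => X (pair t d)) x.
Proof.
  rewrite (sat_iter_tuple (fun P => forall b, exists x, b < x /\ P x)
    (fun t g => X (pair t (g 0%nat)))).
  - reflexivity.
  - intros e' p. apply sat_fExInf.
  - intros e'. rewrite Nat.add_0_r. reflexivity.
Qed.

Lemma models_ElemIndec n : models M (ElemIndec (S n)) <-> indecomposable n.
Proof.
  split.
  - intros H k X SX HX. destruct (s_sets_nonempty M) as [Y SY].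
    destruct (H (fun _ => 0) (fun _ => Y) (fun _ => SY) k X SX) as (d & Ld & K).
    + apply sat_is_coloring. exact HX.
    + exists d. split; [exact Ld|]. exact (proj1 (sat_infinitely_often _ _ _ _ _) K).
  - intros H e E SE k X SX HX. apply sat_is_coloring in HX.
    destruct (H k X SX HX) as (d & Ld & K). exists d. split; [exact Ld|].
    apply sat_infinitely_often. exact K.
Qed.

Lemma models_bounding n p : Coll (set_oracles (M := M)) n -> Pi0 n p ->
  models M (bounding_for p).
Proof.
  intros C Hp e E SE. unfold bounding_for, fBAll, fBEx. simpl. intros a H.
  pose (R := fun x y => sat (scons y (scons x e)) E p).
  assert (K1 : forall x y a, sat (scons y (scons x (scons a e))) E (subst (skip2 1) p) <-> R x y).
  { intros x y c. rewrite sat_subst. unfold R.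
    match goal with |- sat ?u _ _ <-> sat ?v _ _ => replace u with v; [reflexivity|] end.
    apply functional_extensionality. now intros [|[|i]]. }
  assert (K2 : forall x y b a, sat (scons y (scons x (scons b (scons a e)))) E
    (subst (skip2 2) p) <-> R x y).
  { intros x y c b. rewrite sat_subst. unfold R.
    match goal with |- sat ?u _ _ <-> sat ?v _ _ => replace u with v; [reflexivity|] end.
    apply functional_extensionality. now intros [|[|i]]. }
  destruct (C R) with (a := a) as [b Hb].
  - pose proof (formula_hier SE (b := false) Hp) as HR.
    refine (hier_ext (hier_subst (ts := scons (fun e => e 1%nat) (scons (fun e => e 0%nat)
      (fun i _ => e i))) HR _) _).
    + intros [|[|i]]; [exact (tm_var 1)|exact (tm_var 0)|exact (tm_const (e i))].
    + intros e'. unfold R.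
      match goal with |- sat ?u _ _ <-> sat ?v _ _ => replace v with u; [reflexivity|] end.
      apply functional_extensionality. now intros [|[|i]].
  - intros x Lx. destruct (H x Lx) as [y Hy]. exists y. now apply K1 in Hy.
  - exists b. intros x Lx. destruct (Hb x Lx) as (y & Ly & Hy).
    exists y. split; [exact Ly|]. now apply K2.
Qed.

End Arithmetic.

Theorem theorem2p2 (n : nat) (hn : 1 <= n) :
  implies_over RCA0 (single (ElemIndec n)) (BPi n) /\
  implies_over RCA0 (ISigma (S n)) (single (ElemIndec n)).
Proof.
  destruct n as [|n]; [now apply Nat.nle_succ_0 in hn|].
  assert (Base : forall M T, models_theory M (union RCA0 T) ->
    models_theory M T /\ arith M /\ Ind (set_oracles (M := M)) 1 /\
    models_theory M Delta01_CA).
  { intros M T HM.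
    assert (I1 : Ind (set_oracles (M := M)) 1).
    { apply models_Ind. intros p Hp. apply HM. left. right. now left. }
    split; [intros p Hp; apply HM; now right|]. split; [|split; [exact I1|]].
    - constructor.
      + intros p Hp. apply HM. left. now left.
      + apply (Ind_mono (O' := set_oracles (M := M))); [easy|exact I1].
    - intros p Hp. apply HM. left. right. now right. }
  split; intros M HM; destruct (Base M _ HM) as (HT & HA & I1 & CA).
  - intros p [q Hq]. refine (models_bounding _ Hq).
    apply (indecomposable_all_Coll I1 (fun P => models_set CA)).
    exact (proj1 (models_ElemIndec n) (HT _ eq_refl)).
  - intros p ->. exact (proj2 (models_ElemIndec n) (Ind_indecomposable (models_Ind HT))).
Qed.
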